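(* Let $d,n\ge 1$ and let $A_0,A_1,\dots,A_n\in\mathbb{C}^{d\times d}_{\mathrm{herm}}$. Put $\Phi(S)=\sum_{i=1}^n A_iSA_i$. Consider the following three optimization problems. (P) the infimum of $c$ over $c\in\mathbb{R}$, $Z\in\mathbb{C}^{d\times d}_{\mathrm{herm}}$ subject to $$\begin{bmatrix} cI_d-A_0-\Phi(Z) & I_d\\ I_d & Z\end{bmatrix}\succeq 0;$$ (D) the supremum of $\langle A_0,S\rangle+2\,\mathrm{Re}(\mathrm{Tr}(T))$ over $S\in\mathbb{C}^{d\times d}_{\mathrm{herm}}$, $T\in\mathbb{C}^{d\times d}$ subject to $$\begin{bmatrix} S & -T\\ -T^* & \Phi(S)\end{bmatrix}\succeq 0,\qquad \mathrm{Tr}(S)=1;$$ (D') the supremum of $\langle A_0,S\rangle+2\|S^{1/2}\Phi(S)^{1/2}\|_*$ over $S\in\mathbb{C}^{d\times d}_{\mathrm{herm}}$ with $S\succeq 0$, $\mathrm{Tr}(S)=1$. Then the values of (P), (D) and (D') are all equal to $\Lambda_{\mathrm{sc}}(A_0,A_1,\dots,A_n)$. The problems (P) and (D) are Lagrangian duals of one another. The suprema in (D) and (D') are always achieved (i.e. are maxima). If $\bigcap_{i=1}^n\ker(A_i)=\{0\}$, then the infimum in (P) is achieved, and so is the infimum $$\inf_{Z\in\mathbb{C}^{d\times d}_{\mathrm{herm}},\,Z\succ 0}\lambda_{\max}\Big(Z+A_0+\sum_{i=1}^n A_iZ^{-1}A_i\Big).$$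
   Context: $\mathbb{C}^{d\times d}_{\mathrm{herm}}$ is the set of $d\times d$ complex Hermitian matrices; $\succeq$, $\succ$ denote the Loewner order; $\langle X,Y\rangle=\mathrm{Tr}(X^*Y)$; $\|Y\|_*=\mathrm{Tr}((YY^* )^{1/2})$ is the nuclear norm. For a bounded self-adjoint operator, $\lambda_{\max}$ is the maximum of its spectrum. A free semicircular family $(s_i)_{i=1}^n$ consists of freely independent self-adjoint operators each with the standard semicircle law on $[-2,2]$; concretely $s_i=l_i+l_i^*$ with $l_i$ the creation operators on the full Fock space over $\mathbb{C}^n$ associated to the standard basis vectors. Define $$\Lambda_{\mathrm{sc}}(A_0,\dots,A_n)=\lambda_{\max}\Big(A_0\otimes 1+\sum_{i=1}^n A_i\otimes s_i\Big).$$ Known theorem of Lehner (1999), which may be taken as an equivalent definition: $\Lambda_{\mathrm{sc}}(A_0,\dots,A_n)=\inf_{Z\in\mathbb{C}^{d\times d}_{\mathrm{herm}},Z\succ 0}\lambda_{\max}\big(Z+A_0+\sum_{i=1}^n A_iZ^{-1}A_i\big)$. *)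

(* Defs.v *)
From HB Require Import structures.
From mathcomp Require Import all_boot all_order all_algebra.
From mathcomp Require Import sesquilinear spectral.
From mathcomp Require Import complex.
From mathcomp Require Import classical_sets functions reals ereal.

Set Implicit Arguments.
Unset Strict Implicit.
Unset Printing Implicit Defensive.

Import Order.TTheory GRing.Theory Num.Theory.

Local Open Scope classical_set_scope.
Local Open Scope sesquilinear_scope.
Local Open Scope complex_scope.
Local Open Scope ring_scope.

Section Matrices.
Context {R : realType}.
Notation C := R[i].

(* In the partial order of [C], [0 <= z] means that z is real and nonnegative. *)
Definition psd m (M : 'M[C]_m) : Prop :=
  M \is hermsymmx /\ forall x : 'cV[C]_m, 0 <= (x^t* *m M *m x) 0 0.

Definition posdef m (M : 'M[C]_m) : Prop :=
  M \is hermsymmx /\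
  forall x : 'cV[C]_m, x != 0 -> 0 < (x^t* *m M *m x) 0 0.

(* Meant for Hermitian M, whose spectrum is real; the maximum exists as soon
   as 0 < m. *)
Definition lambda_max m (M : 'M[C]_m) : R :=
  sup [set x : R | eigenvalue M x%:C].

(* <X, Y> = Tr(X^* Y) is real for Hermitian X and Y, the only case used;
   [ipmx] is its real part. *)
Definition ipmx m (X Y : 'M[C]_m) : R := complex.Re (\tr (X^t* *m Y)).

(* Spectral functional calculus; see [sqrtmxP]. *)
Definition sqrtmx m (M : 'M[C]_m) : 'M[C]_m :=
  invmx (spectralmx M) *m diag_mx (map_mx sqrtC (spectral_diag M))
    *m spectralmx M.

Definition nuclear_norm m (Y : 'M[C]_m) : R :=
  complex.Re (\tr (sqrtmx (Y *m Y^t*))).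

Lemma sqrtmxP m (M : 'M[C]_m) : psd M ->
  psd (sqrtmx M) /\ sqrtmx M *m sqrtmx M = M.
Proof.
move=> [Mh Mpos].
have [Mn Mr] := (hermitian_normalmx Mh, hermitian_spectral_diag_real Mh).
have Pu := spectral_unitarymx M.
have /orthomx_spectralP Msp := Mn.
have Pi := invmx_unitary Pu.
have PU := spectral_unit M.
have sp0 i : 0 <= spectral_diag M 0 i.
  have := Mpos ((spectralmx M)^t* *m delta_mx i 0).
  rewrite trmx_mul map_mxM /= trmxCK {2}Msp Pi !mulmxA.
  rewrite (mulmxtVK _ Pu) (mulmxtVK _ Pu) mul_mx_diag mxE.
  rewrite (bigD1 i) //= big1 => [|j ji]; rewrite !mxE.
    by rewrite !eqxx /= rmorph1 mul1r mulr1 addr0.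
  by rewrite (negPf ji) mulr0.
split; last first.
  rewrite /sqrtmx !mulmxA mulmxK // -[_ *m diag_mx _ *m diag_mx _]mulmxA mulmx_diag.
  rewrite [X in diag_mx X](_ : _ = spectral_diag M) -?Msp //.
  by apply/rowP => i; rewrite !mxE -expr2 sqrtCK.
have Sd : sqrtmx M =
    (spectralmx M)^t* *m diag_mx (map_mx sqrtC (spectral_diag M)) *m spectralmx M.
  by rewrite /sqrtmx Pi.
split.
  apply/is_hermitianmxP; rewrite expr0 scale1r Sd.
  rewrite !trmx_mul !map_mxM /= trmxCK mulmxA tr_diag_mx map_diag_mx.
  congr (_ *m diag_mx _ *m _); apply/rowP => i; rewrite !mxE.
  by apply/esym/CrealP/ger0_real; rewrite sqrtC_ge0.
move=> x; rewrite Sd !mulmxA.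
set y := spectralmx M *m x.
have -> : x^t* *m (spectralmx M)^t* = y^t* by rewrite trmx_mul map_mxM.
rewrite -mulmxA -/y mul_mx_diag mxE sumr_ge0 // => i _; rewrite !mxE.
by rewrite mulrAC mulr_ge0 ?sqrtC_ge0 // mulrC mul_conjC_ge0.
Qed.

End Matrices.

Section Optimization.
Context {R : realType} {T : Type}.

Definition inf_val (X : set T) (f : T -> R) : \bar R :=
  ereal_inf [set (f x)%:E | x in X].

Definition sup_val (X : set T) (f : T -> R) : \bar R :=
  ereal_sup [set (f x)%:E | x in X].

Definition attained (X : set T) (f : T -> R) (v : \bar R) : Prop :=
  exists2 x, X x & (f x)%:E = v.

End Optimization.

(* Data of an optimization problem over the variable v \in sdp_dom, subject to
   the constraints sdp_lmi v >= 0 (Loewner order) and sdp_eqn v = 0.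
   Whether sdp_obj is minimized or maximized is left to the context. *)
Record sdp (R : realType) (V : Type) (m k : nat) := SDP {
  sdp_dom : set V;
  sdp_obj : V -> R;
  sdp_lmi : V -> 'M[R[i]]_m;
  sdp_eqn : V -> 'rV[R]_k }.

Section Duality.
Context {R : realType} {V : Type} {m k : nat}.
Implicit Type p : sdp R V m k.

Definition feasible p : set V :=
  [set v | [/\ sdp_dom p v, psd (sdp_lmi p v) & sdp_eqn p v = 0]].

(* The second argument is the pair of Lagrange multipliers (W, mu), with W >= 0
   attached to the semidefinite constraint and mu (of any sign) to the
   equations. The Lagrangian of max f is the opposite of that of min (- f). *)
Definition min_lagrangian p (w : 'M[R[i]]_m * 'rV[R]_k) (v : V) : R :=
  sdp_obj p v - ipmx w.1 (sdp_lmi p v)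
  + \sum_(j < k) w.2 0 j * sdp_eqn p v 0 j.

Definition max_lagrangian p (w : 'M[R[i]]_m * 'rV[R]_k) (v : V) : R :=
  sdp_obj p v + ipmx w.1 (sdp_lmi p v)
  - \sum_(j < k) w.2 0 j * sdp_eqn p v 0 j.

(* The dual of a minimization problem is the maximization of
   [min_dual_fun p w] over the multipliers w with W >= 0; the multipliers at
   which this function is -oo are excluded by [min_dual_feasible]. *)
Definition min_dual_fun p w : \bar R :=
  inf_val (sdp_dom p) (min_lagrangian p w).

Definition min_dual_feasible p : set ('M[R[i]]_m * 'rV[R]_k) :=
  [set w | psd w.1 /\ min_dual_fun p w != -oo%E].

Definition max_dual_fun p w : \bar R :=
  sup_val (sdp_dom p) (max_lagrangian p w).

Definition max_dual_feasible p : set ('M[R[i]]_m * 'rV[R]_k) :=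
  [set w | psd w.1 /\ max_dual_fun p w != +oo%E].

End Duality.

(* The maximization problem q is the Lagrangian dual of the minimization
   problem p, where phi gives the multipliers of p in terms of the variables
   of q. *)
Definition is_dual_of_min (R : realType) (V V' : Type) (m k m' k' : nat)
    (p : sdp R V m k) (q : sdp R V' m' k')
    (phi : V' -> 'M[R[i]]_m * 'rV[R]_k) : Prop :=
  set_bij (feasible q) (min_dual_feasible p) phi /\
  forall v, feasible q v -> min_dual_fun p (phi v) = (sdp_obj q v)%:E.

Definition is_dual_of_max (R : realType) (V V' : Type) (m k m' k' : nat)
    (p : sdp R V m k) (q : sdp R V' m' k')
    (phi : V' -> 'M[R[i]]_m * 'rV[R]_k) : Prop :=
  set_bij (feasible q) (max_dual_feasible p) phi /\
  forall v, feasible q v -> max_dual_fun p (phi v) = (sdp_obj q v)%:E.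

Section Problems.
Context {R : realType} {d n : nat}.
Notation C := R[i].
Variables (A0 : 'M[C]_d) (A : 'I_n -> 'M[C]_d).

Definition Phi (S : 'M[C]_d) : 'M[C]_d := \sum_i A i *m S *m A i.

Definition lehner (Z : 'M[C]_d) : R :=
  lambda_max (Z + A0 + \sum_i A i *m invmx Z *m A i).

(* Lambda_sc is defined by Lehner's formula for the top of the spectrum of
   A_0 (x) 1 + sum_i A_i (x) s_i, with s_i a free semicircular family. *)
Definition Lambda_sc : \bar R := inf_val [set Z | posdef Z] lehner.

Definition probP : sdp R (R * 'M[C]_d) (d + d) 0 := {|
  sdp_dom := [set cZ | cZ.2 \is hermsymmx];
  sdp_obj := fun cZ => cZ.1;
  sdp_lmi := fun cZ =>
    block_mx ((cZ.1)%:C%:M - A0 - Phi cZ.2) 1%:M 1%:M cZ.2;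
  sdp_eqn := fun=> 0 |}.

Definition probD : sdp R ('M[C]_d * 'M[C]_d) (d + d) 1 := {|
  sdp_dom := [set ST | ST.1 \is hermsymmx];
  sdp_obj := fun ST => ipmx A0 ST.1 + 2 * complex.Re (\tr ST.2);
  sdp_lmi := fun ST => block_mx ST.1 (- ST.2) (- ST.2^t*) (Phi ST.1);
  (* the trace of the Hermitian matrix S is real; see [feasibleD] *)
  sdp_eqn := fun ST => const_mx (complex.Re (\tr ST.1) - 1) |}.

Definition feasibleD' : set 'M[C]_d := [set S | psd S /\ \tr S = 1].

Definition objD' (S : 'M[C]_d) : R :=
  ipmx A0 S + 2 * nuclear_norm (sqrtmx S *m sqrtmx (Phi S)).

Lemma feasibleP c Z : feasible probP (c, Z) <->
  Z \is hermsymmx /\ psd (block_mx (c%:C%:M - A0 - Phi Z) 1%:M 1%:M Z).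
Proof. by split=> [[]|[]]. Qed.

Lemma feasibleD S T : feasible probD (S, T) <->
  [/\ S \is hermsymmx, psd (block_mx S (- T) (- T^t*) (Phi S)) & \tr S = 1].
Proof.
split=> -[/= Sh Sp St]; split=> //=; last first.
  by rewrite St; apply/rowP => j; rewrite !mxE subrr.
move: St => /rowP/(_ 0); rewrite !mxE => /eqP; rewrite subr_eq0 => /eqP St.
have : \tr S = (\tr S)^*%R.
  have /is_hermitianmxP := Sh; rewrite expr0 scale1r => {1}->.
  by rewrite trace_map_mx mxtrace_tr.
case: (\tr S) St => a b /= -> /eqP; rewrite eq_complex /= eqxx /= => /eqP b0.
have /eqP : b *+ 2 = 0 by rewrite mulr2n {1}b0 addNr.
by rewrite mulrn_eq0 /= => /eqP ->.
Qed.

End Problems.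

(* Main.v *)
Require Import Defs.
From HB Require Import structures.
From mathcomp Require Import all_boot all_order all_algebra.
From mathcomp Require Import sesquilinear spectral.
From mathcomp Require Import complex.
From mathcomp Require Import classical_sets functions reals ereal.
From mathcomp Require Import boolp topology normedtype derive.
From mathcomp Require Import ring lra.

(** Lehner's formula becomes problem (P) after the substitution of [Z^-1] for
   [Z] and a Schur complement, so the value of (P) is [Lambda_sc] at once
   ([inf_probP]). The Lagrangian of (P) is affine in [(c, Z)] and that of (D)
   is affine in [(S, T)]; an affine function is bounded only if its slope
   vanishes, and the slope conditions are the constraints of the other problem
   ([probD_dual_of_probP], [probP_dual_of_probD]). Weak duality is the
   positivity of the trace pairing of two positive semidefinite matrices
   ([weak_duality]).

   Strong duality and all attainment statements rest on one separation theorem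
   ([closed_image_separation]). Let [L] be a linear map which kills no nonzero
   positive semidefinite matrix, and [p] a point of its target. By compactness
   the image of the cone has a point nearest to [p], and the residual at this
   point either is zero, so that [p] is in the image, or separates [p] from
   the image.
   - For (D), [L] sends the block matrix with entries [S], [- T], [U] to
     [U - Phi S], the trace of [S] and the objective, and [p] asks for the
     values [0], [1] and [v], where [v] is the value of (P). A separating
     residual would be, up to scaling, a primal feasible point with a value
     below [v], or else contradict weak duality. So (D) has a point of value
     [v] ([dual_attained]).
   - For (P), [L] sends a block matrix [N] to its off-diagonal blocks and to
     [N11 + Phi N22], and [p] asks for [1] and [v - A0]. That [L] kills no
     nonzero matrix of the cone is where the common kernel of the [A i] enters
     ([Phi_faithful]). Since feasible values approach [v], nothing separates
     ([primal_attained]).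

   Problem (D') is (D) with [T] eliminated: for fixed positive semidefinite
   diagonal blocks [S] and [U], the largest real part of the trace of the
   off-diagonal block is the nuclear norm of [S^(1/2) U^(1/2)]
   ([block_trace_le], [block_trace_attained]). Both bounds come from polar
   decompositions. *)

Set Implicit Arguments.
Unset Strict Implicit.
Unset Printing Implicit Defensive.

Import Order.TTheory GRing.Theory Num.Theory.

Local Open Scope classical_set_scope.
Local Open Scope sesquilinear_scope.
Local Open Scope complex_scope.
Local Open Scope ring_scope.

(** * Complex matrices and positive semidefiniteness *)

Section ComplexParts.
Context {R : realType}.
Implicit Types (x y : R[i]) (a : R).

Lemma ReD x y : complex.Re (x + y) = complex.Re x + complex.Re y.
Proof. by case: x y => [? ?] []. Qed.

Lemma ImD x y : complex.Im (x + y) = complex.Im x + complex.Im y.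
Proof. by case: x y => [? ?] []. Qed.

Lemma ReN x : complex.Re (- x) = - complex.Re x.
Proof. by case: x. Qed.

Lemma ReZ a x : complex.Re (a%:C * x) = a * complex.Re x.
Proof. by case: x => u v /=; rewrite mul0r subr0. Qed.

Lemma ImZ a x : complex.Im (a%:C * x) = a * complex.Im x.
Proof. by case: x => u v /=; rewrite mul0r addr0. Qed.

Lemma ReJ x : complex.Re (x^*)%R = complex.Re x.
Proof. by case: x. Qed.

Lemma Re_sum I (r : seq I) (F : I -> R[i]) :
  complex.Re (\sum_(i <- r) F i) = \sum_(i <- r) complex.Re (F i).
Proof. exact: (big_morph _ ReD). Qed.

Lemma Im_sum I (r : seq I) (F : I -> R[i]) :
  complex.Im (\sum_(i <- r) F i) = \sum_(i <- r) complex.Im (F i).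
Proof. exact: (big_morph _ ImD). Qed.

Lemma Re_ge0 x : 0 <= x -> 0 <= complex.Re x.
Proof. by rewrite lecE => /andP[]. Qed.

Lemma conjC_real a : ((a%:C)^*)%R = a%:C :> R[i].
Proof. exact: conjc_real. Qed.

Lemma addJ x : x + (x^*)%R = (2 * complex.Re x)%:C.
Proof.
case: x => a b; apply/eqP.
by rewrite eq_complex /= subrr eqxx mulrDl !mul1r eqxx.
Qed.

Lemma natC m : (m%:R : R)%:C = m%:R :> R[i].
Proof. by rewrite rmorph_nat. Qed.

End ComplexParts.

Section ConjTranspose.
Context {R : realType}.
Notation C := R[i].

Lemma ctrM m n p (A : 'M[C]_(m, n)) (B : 'M[C]_(n, p)) :
  (A *m B)^t* = B^t* *m A^t*.
Proof. by rewrite trmx_mul map_mxM. Qed.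

Lemma ctrD m n (A B : 'M[C]_(m, n)) : (A + B)^t* = A^t* + B^t*.
Proof. by rewrite linearD map_mxD. Qed.

Lemma ctrN m n (A : 'M[C]_(m, n)) : (- A)^t* = - A^t*.
Proof. by rewrite linearN map_mxN. Qed.

Lemma ctr0 m n : (0 : 'M[C]_(m, n))^t* = 0.
Proof. by rewrite trmx0 map_mx0. Qed.

Lemma ctrZ m n (a : R) (A : 'M[C]_(m, n)) : (a%:C *: A)^t* = a%:C *: A^t*.
Proof. by rewrite linearZ map_mxZ /= conjC_real. Qed.

Lemma ctr_scalar n (a : R) : (a%:C%:M : 'M[C]_n)^t* = a%:C%:M.
Proof. by rewrite tr_scalar_mx map_scalar_mx /= conjC_real. Qed.

Lemma ctr1 n : (1%:M : 'M[C]_n)^t* = 1%:M.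
Proof. exact: (ctr_scalar n 1). Qed.

Lemma ctr_block m n p q (A : 'M[C]_(m, p)) (B : 'M[C]_(m, q))
    (E : 'M[C]_(n, p)) (F : 'M[C]_(n, q)) :
  (block_mx A B E F)^t* = block_mx (A^t*) (E^t*) (B^t*) (F^t*).
Proof. by rewrite tr_block_mx map_block_mx. Qed.

Lemma ctr_row m n p (A : 'M[C]_(m, n)) (B : 'M[C]_(m, p)) :
  (row_mx A B)^t* = col_mx (A^t*) (B^t*).
Proof. by rewrite tr_row_mx map_col_mx. Qed.

Lemma ctr_col m n p (A : 'M[C]_(m, p)) (B : 'M[C]_(n, p)) :
  (col_mx A B)^t* = row_mx (A^t*) (B^t*).
Proof. by rewrite tr_col_mx map_row_mx. Qed.

Lemma mxtrace_ctr n (A : 'M[C]_n) : \tr (A^t*) = ((\tr A)^*)%R.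
Proof. by rewrite trace_map_mx mxtrace_tr. Qed.

Lemma submx_linear d (a : C) (X Y : 'M[C]_(d + d)) :
  [/\ ulsubmx (a *: X + Y) = a *: ulsubmx X + ulsubmx Y,
      ursubmx (a *: X + Y) = a *: ursubmx X + ursubmx Y,
      dlsubmx (a *: X + Y) = a *: dlsubmx X + dlsubmx Y
    & drsubmx (a *: X + Y) = a *: drsubmx X + drsubmx Y].
Proof. by split; apply/matrixP => i j; rewrite !mxE. Qed.

Lemma scalar_mx1_linear (a x y : C) :
  (a * x + y)%:M = a *: x%:M + y%:M :> 'M[C]_1.
Proof. by apply/matrixP => i j; rewrite !ord1 !mxE eqxx !mulr1n. Qed.

Lemma scalar_mx1B (x y : C) : (x - y)%:M = x%:M - y%:M :> 'M[C]_1.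
Proof. by apply/matrixP => i j; rewrite !ord1 !mxE eqxx !mulr1n. Qed.

Lemma hermP n (A : 'M[C]_n) : A \is hermsymmx <-> A^t* = A.
Proof.
split=> [/is_hermitianmxP|e]; first by rewrite expr0 scale1r => <-.
by apply/is_hermitianmxP; rewrite expr0 scale1r.
Qed.

Lemma hermD n (A B : 'M[C]_n) :
  A \is hermsymmx -> B \is hermsymmx -> A + B \is hermsymmx.
Proof. by move=> /hermP Ah /hermP Bh; apply/hermP; rewrite ctrD Ah Bh. Qed.

Lemma hermN n (A : 'M[C]_n) : A \is hermsymmx -> - A \is hermsymmx.
Proof. by move=> /hermP Ah; apply/hermP; rewrite ctrN Ah. Qed.

Lemma hermB n (A B : 'M[C]_n) :
  A \is hermsymmx -> B \is hermsymmx -> A - B \is hermsymmx.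
Proof. by move=> Ah Bh; rewrite hermD ?hermN. Qed.

Lemma hermZ n (a : R) (A : 'M[C]_n) :
  A \is hermsymmx -> a%:C *: A \is hermsymmx.
Proof. by move=> /hermP Ah; apply/hermP; rewrite ctrZ Ah. Qed.

Lemma herm_scalar n (a : R) : (a%:C%:M : 'M[C]_n) \is hermsymmx.
Proof. exact/hermP/ctr_scalar. Qed.

Lemma herm0 n : (0 : 'M[C]_n) \is hermsymmx.
Proof. by apply/hermP; rewrite ctr0. Qed.

Lemma herm_congr m n (G : 'M[C]_(m, n)) (A : 'M[C]_m) :
  A \is hermsymmx -> G^t* *m A *m G \is hermsymmx.
Proof.
by move=> /hermP Ah; apply/hermP; rewrite !ctrM trmxCK Ah mulmxA.
Qed.

Lemma herm_block m n (A : 'M[C]_m) (B : 'M[C]_(m, n)) (D : 'M[C]_n) :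
  A \is hermsymmx -> D \is hermsymmx -> block_mx A B (B^t*) D \is hermsymmx.
Proof.
by move=> /hermP Ah /hermP Dh; apply/hermP; rewrite ctr_block trmxCK Ah Dh.
Qed.

Lemma herm_blockP m n (W : 'M[C]_(m + n)) : W \is hermsymmx ->
  [/\ ulsubmx W \is hermsymmx, drsubmx W \is hermsymmx
    & W = block_mx (ulsubmx W) (ursubmx W) ((ursubmx W)^t*) (drsubmx W)].
Proof.
move=> /hermP; rewrite -{1 2}(submxK W) ctr_block => /eq_block_mx[a b c d].
by split; [exact/(hermP _).2 | exact/(hermP _).2 | rewrite c submxK].
Qed.

Lemma herm_form_real n (A : 'M[C]_n) (x : 'cV[C]_n) : A \is hermsymmx ->
  ((complex.Re ((x^t* *m A *m x) 0 0))%:C) = (x^t* *m A *m x) 0 0.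
Proof.
move=> /(herm_congr x)/hermP; set N := _ *m x => /matrixP/(_ 0 0).
by rewrite !mxE => Nr; apply/RRe_real/CrealP.
Qed.

Lemma herm_trace_real n (A : 'M[C]_n) : A \is hermsymmx ->
  (complex.Re (\tr A))%:C = \tr A.
Proof.
by move=> /hermP Ah; apply/RRe_real/CrealP; rewrite -mxtrace_ctr Ah.
Qed.

Lemma psdE n (A : 'M[C]_n) : A \is hermsymmx ->
  (forall x : 'cV[C]_n, 0 <= complex.Re ((x^t* *m A *m x) 0 0)) -> psd A.
Proof. by move=> Ah Ap; split=> // x; rewrite -herm_form_real // ler0c. Qed.

Lemma mulCx_ge0 n (x : 'cV[C]_n) : 0 <= (x^t* *m x) 0 0.
Proof.
by rewrite mxE sumr_ge0 // => i _; rewrite !mxE mulrC mul_conjC_ge0.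
Qed.

Lemma mulCx_eq0 n (x : 'cV[C]_n) : (x^t* *m x) 0 0 = 0 -> x = 0.
Proof.
rewrite mxE => /eqP; rewrite psumr_eq0 => [/allP x0|i _]; last first.
  by rewrite !mxE mulrC mul_conjC_ge0.
apply/colP => i; have := x0 i; rewrite mem_index_enum !mxE mulrC mul_conjC_eq0.
by move=> /(_ isT)/eqP.
Qed.

End ConjTranspose.

Section Psd.
Context {R : realType}.
Notation C := R[i].

Lemma psd0 n : psd (0 : 'M[C]_n).
Proof. by split=> [|x]; rewrite ?herm0 // mulmx0 mul0mx mxE. Qed.

Lemma psdD n (A B : 'M[C]_n) : psd A -> psd B -> psd (A + B).
Proof.
move=> [Ah Ap] [Bh Bp]; split=> [|x]; first exact: hermD.
by rewrite mulmxDr mulmxDl mxE addr_ge0.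
Qed.

Lemma psdZ n (a : R) (A : 'M[C]_n) : 0 <= a -> psd A -> psd (a%:C *: A).
Proof.
move=> a0 [Ah Ap]; split=> [|x]; first exact: hermZ.
by rewrite -scalemxAr -scalemxAl mxE mulr_ge0 // ler0c.
Qed.

Lemma psd_congr m n (G : 'M[C]_(m, n)) (A : 'M[C]_m) :
  psd A -> psd (G^t* *m A *m G).
Proof.
move=> [Ah Ap]; split=> [|x]; first exact: herm_congr.
by have := Ap (G *m x); rewrite ctrM !mulmxA.
Qed.

Lemma psd1 n : psd (1%:M : 'M[C]_n).
Proof.
split=> [|x]; first exact: (herm_scalar n 1).
by rewrite mulmx1 mulCx_ge0.
Qed.

Lemma psd_gram m n (B : 'M[C]_(m, n)) : psd (B^t* *m B).
Proof. by rewrite -[B^t*]mulmx1; apply/psd_congr/psd1. Qed.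

Lemma psd_sum n (I : finType) (F : I -> 'M[C]_n) :
  (forall i, psd (F i)) -> psd (\sum_i F i).
Proof. move=> Fp; apply: (big_ind (@psd R n)); first exact: psd0.
  exact: psdD.
by move=> i _. Qed.

Lemma sqrtmx_herm n (A : 'M[C]_n) : psd A -> (sqrtmx A)^t* = sqrtmx A.
Proof. by case/sqrtmxP => [[/hermP]]. Qed.

Lemma sqrtmxK n (A : 'M[C]_n) : psd A -> sqrtmx A *m sqrtmx A = A.
Proof. by case/sqrtmxP. Qed.

(** A null vector of the quadratic form is a null vector of the matrix, since
   the form is the squared norm of [sqrtmx A *m x]. *)
Lemma psd_form_eq0 n (A : 'M[C]_n) (x : 'cV[C]_n) :
  psd A -> (x^t* *m A *m x) 0 0 = 0 -> A *m x = 0.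
Proof.
move=> Ap; rewrite -{1 2}(sqrtmxK Ap) -{1}(sqrtmx_herm Ap) mulmxA -ctrM -mulmxA.
by move=> /mulCx_eq0 e; rewrite -mulmxA e mulmx0.
Qed.

Lemma posdef_psd n (A : 'M[C]_n) : posdef A -> psd A.
Proof.
move=> [Ah Ap]; split=> // x; have [->|/Ap/ltW //] := eqVneq x 0.
by rewrite mulmx0 mxE.
Qed.

Lemma psd_posdef n (A : 'M[C]_n) :
  psd A -> (forall x : 'cV[C]_n, A *m x = 0 -> x = 0) -> posdef A.
Proof.
move=> Ap A0; split=> [|x xn0]; first by case: Ap.
rewrite lt_def (Ap.2 x) andbT; apply: contra xn0 => /eqP.
by move=> /(psd_form_eq0 Ap)/A0 ->.
Qed.

Lemma posdef_unit n (A : 'M[C]_n) : posdef A -> A \in unitmx.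
Proof.
move=> [/hermP Ah Ap]; rewrite -row_free_unit -kermx_eq0.
apply/eqP/row_matrixP => i; rewrite row0.
have : row i (kermx A) *m A = 0 by rewrite -row_mul mulmx_ker row0.
move: (row i _) => v vA; apply/eqP/negPn/negP => vn0.
have := Ap (v^t*); rewrite trmxCK vA mul0mx mxE ltxx => /(_ _)/notF; apply.
apply: contra vn0 => /eqP/(congr1 (fun w => w^t*)).
by rewrite trmxCK ctr0 => ->.
Qed.

Lemma posdef_inv n (A : 'M[C]_n) : posdef A -> posdef (invmx A).
Proof.
move=> Ap; have Au := posdef_unit Ap; have [/hermP Ah _] := Ap.
have iE : (invmx A)^t* *m A *m invmx A = invmx A.
  by rewrite -mulmxA mulmxV // mulmx1 trmx_inv map_invmx Ah.
apply: psd_posdef => [|x]; first by rewrite -iE; apply/psd_congr/posdef_psd.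
by move=> /(congr1 (mulmx A)); rewrite mulKVmx // mulmx0.
Qed.

End Psd.

(** * The trace inner product and self-duality of the cone *)

Section InnerProduct.
Context {R : realType}.
Notation C := R[i].

Lemma ipmxE n (X Y : 'M[C]_n) : ipmx X Y =
  \sum_i \sum_j (complex.Re (X i j) * complex.Re (Y i j)
                 + complex.Im (X i j) * complex.Im (Y i j)).
Proof.
rewrite /ipmx /mxtrace Re_sum exchange_big /=; apply: eq_bigr => j _.
rewrite mxE Re_sum; apply: eq_bigr => i _; rewrite !mxE.
by case: (X i j) (Y i j) => [a b] [c e] /=; rewrite mulNr opprK.
Qed.

Lemma ipmxC n (X Y : 'M[C]_n) : ipmx X Y = ipmx Y X.
Proof. by rewrite /ipmx -ReJ -mxtrace_ctr ctrM trmxCK. Qed.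

Lemma ipmxDr n (X Y Z : 'M[C]_n) : ipmx X (Y + Z) = ipmx X Y + ipmx X Z.
Proof. by rewrite /ipmx mulmxDr mxtraceD ReD. Qed.

Lemma ipmxNr n (X Y : 'M[C]_n) : ipmx X (- Y) = - ipmx X Y.
Proof. by rewrite /ipmx mulmxN linearN ReN. Qed.

Lemma ipmxZr n (a : R) (X Y : 'M[C]_n) : ipmx X (a%:C *: Y) = a * ipmx X Y.
Proof. by rewrite /ipmx -scalemxAr linearZ ReZ. Qed.

Lemma ipmxDl n (X Y Z : 'M[C]_n) : ipmx (X + Y) Z = ipmx X Z + ipmx Y Z.
Proof. by rewrite ipmxC ipmxDr !(ipmxC Z). Qed.

Lemma ipmxNl n (X Y : 'M[C]_n) : ipmx (- X) Y = - ipmx X Y.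
Proof. by rewrite ipmxC ipmxNr ipmxC. Qed.

Lemma ipmxZl n (a : R) (X Y : 'M[C]_n) : ipmx (a%:C *: X) Y = a * ipmx X Y.
Proof. by rewrite ipmxC ipmxZr ipmxC. Qed.

Lemma ipmx0r n (X : 'M[C]_n) : ipmx X 0 = 0.
Proof. by rewrite /ipmx mulmx0 mxtrace0. Qed.

Lemma ipmx_scalarl n (a : R) (X : 'M[C]_n) :
  ipmx a%:C%:M X = a * complex.Re (\tr X).
Proof. by rewrite /ipmx ctr_scalar mul_scalar_mx linearZ ReZ. Qed.

Lemma ipmx1l n (X : 'M[C]_n) : ipmx 1%:M X = complex.Re (\tr X).
Proof. by rewrite (ipmx_scalarl 1) mul1r. Qed.

Lemma ipmx_ge0 n (X : 'M[C]_n) : 0 <= ipmx X X.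
Proof.
rewrite ipmxE; apply: sumr_ge0 => i _; apply: sumr_ge0 => j _.
by rewrite addr_ge0 // -expr2 sqr_ge0.
Qed.

Lemma ipmx_eq0 n (X : 'M[C]_n) : ipmx X X = 0 -> X = 0.
Proof.
have pos i j : 0 <= complex.Re (X i j) * complex.Re (X i j)
                 + complex.Im (X i j) * complex.Im (X i j).
  by rewrite addr_ge0 // -expr2 sqr_ge0.
rewrite ipmxE => /eqP; rewrite psumr_eq0 => [/allP e|i _]; last exact: sumr_ge0.
apply/matrixP => i j; have := e i (mem_index_enum _).
rewrite psumr_eq0 // => /allP/(_ j (mem_index_enum _)).
rewrite mxE paddr_eq0 -?expr2 ?sqr_ge0 // !sqrf_eq0 /=.
by case: (X i j) => a b /= /andP[/eqP-> /eqP->].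
Qed.

Lemma ipmx_block m n (A A' : 'M[C]_m) (B B' : 'M[C]_(m, n))
    (D D' : 'M[C]_n) :
  ipmx (block_mx A B (B^t*) D) (block_mx A' B' (B'^t*) D') =
  ipmx A A' + ipmx D D' + 2 * complex.Re (\tr (B^t* *m B')).
Proof.
rewrite /ipmx ctr_block mulmx_block mxtrace_block !mxtraceD !ReD trmxCK.
rewrite [in \tr (B *m _)]mxtrace_mulC -[B' in B'^t* *m B]trmxCK.
have -> : complex.Re (\tr (B'^t* ^t* ^t* *m B)) = complex.Re (\tr (B^t* *m B')).
  by rewrite trmxCK -ReJ -mxtrace_ctr ctrM trmxCK.
by ring.
Qed.

Lemma ipmx_blockD m k (X X' : 'M[C]_m) (Y Y' : 'M[C]_k) :
  ipmx (block_mx X 0 0 Y) (block_mx X' 0 0 Y') = ipmx X X' + ipmx Y Y'.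
Proof.
have := ipmx_block X X' 0 0 Y Y'.
by rewrite !ctr0 mul0mx mxtrace0 mulr0 addr0.
Qed.

Lemma psd_trace_ge0 n (X : 'M[C]_n) : psd X -> 0 <= complex.Re (\tr X).
Proof.
move=> [_ Xp]; rewrite /mxtrace Re_sum; apply: sumr_ge0 => i _.
have := Xp (delta_mx i 0); rewrite trmx_delta map_delta_mx.
by rewrite -rowE -colE !mxE => /Re_ge0.
Qed.

(** Half of the self-duality of the positive semidefinite cone: with [B] the
   square root of [Y], the trace of [X *m Y] is that of [B *m X *m B]. *)
Lemma psd_ipmx n (X Y : 'M[C]_n) : psd X -> psd Y -> 0 <= ipmx X Y.
Proof.
move=> Xp Yp; rewrite /ipmx (hermP _).1; last by case: Xp.
rewrite -(sqrtmxK Yp) mulmxA mxtrace_mulC mulmxA -{1}(sqrtmx_herm Yp).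
exact/psd_trace_ge0/psd_congr.
Qed.

(** The other half of self-duality: rank-one matrices [x *m x^t*] recover the
   quadratic form. *)
Lemma psd_dual n (X : 'M[C]_n) : X \is hermsymmx ->
  (forall Y, psd Y -> 0 <= ipmx X Y) -> psd X.
Proof.
move=> Xh XY; apply: psdE => // x.
have xp : psd (x *m x^t*) by rewrite -{1}(trmxCK x); apply: psd_gram.
have := XY _ xp; rewrite /ipmx (hermP _).1 // mulmxA mxtrace_mulC mulmxA.
by rewrite trace_mx11.
Qed.

Lemma psd_diag_ge0 n (X : 'M[C]_n) i : psd X -> 0 <= X i i.
Proof.
move=> [_ Xp]; have := Xp (delta_mx i 0).
by rewrite trmx_delta map_delta_mx -rowE -colE !mxE.
Qed.

(** The trace of [X] is the squared Hilbert-Schmidt norm of its square root. *)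
Lemma psd_trace_eq0 n (X : 'M[C]_n) : psd X -> complex.Re (\tr X) = 0 -> X = 0.
Proof.
move=> Xp; rewrite -ipmx1l -(sqrtmxK Xp) ipmx1l -{1}(sqrtmx_herm Xp).
by move=> /ipmx_eq0 ->; rewrite mulmx0.
Qed.

Lemma psd_blockD m n (A : 'M[C]_m) (D : 'M[C]_n) :
  psd A -> psd D -> psd (block_mx A 0 0 D).
Proof.
move=> Ap Dp; have -> : block_mx A 0 0 D =
    (row_mx 1%:M 0)^t* *m A *m row_mx 1%:M 0
    + (row_mx 0 1%:M)^t* *m D *m row_mx 0 1%:M.
  rewrite !ctr_row !ctr1 !ctr0 -!mulmxA (mul_mx_row A) (mul_mx_row D).
  rewrite !mul_col_row.
  by rewrite !mulmx1 !mulmx0 !mul0mx !mul1mx add_block_mx !addr0 !add0r.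
by apply: psdD; apply: psd_congr.
Qed.

Lemma psd_block_ul m n (A : 'M[C]_m) (B : 'M[C]_(m, n)) E (D : 'M[C]_n) :
  psd (block_mx A B E D) -> psd A.
Proof.
move=> /(psd_congr (col_mx 1%:M 0)).
rewrite ctr_col ctr1 ctr0 mul_row_block !mul1mx !mul0mx !addr0 mul_row_col.
by rewrite mulmx1 mulmx0 addr0.
Qed.

Lemma psd_block_dr m n (A : 'M[C]_m) (B : 'M[C]_(m, n)) E (D : 'M[C]_n) :
  psd (block_mx A B E D) -> psd D.
Proof.
move=> /(psd_congr (col_mx 0 1%:M)).
rewrite ctr_col ctr1 ctr0 mul_row_block !mul1mx !mul0mx !add0r mul_row_col.
by rewrite mulmx1 mulmx0 add0r.
Qed.

(** The vector [(0, y)] is null for the quadratic form, hence for the matrix. *)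
Lemma psd_block_dr0 m n (A : 'M[C]_m) (B : 'M[C]_(m, n)) E (D : 'M[C]_n)
    (y : 'cV[C]_n) :
  psd (block_mx A B E D) -> D *m y = 0 -> B *m y = 0.
Proof.
move=> Wp Dy; have := @psd_form_eq0 _ _ _ (col_mx 0 y) Wp.
rewrite ctr_col ctr0 mul_row_block !mul0mx !add0r mul_row_col mulmx0 add0r.
rewrite mul_block_col !mulmx0 !add0r Dy -mulmxA Dy mulmx0 mxE.
by move=> /(_ erefl)/eqP; rewrite col_mx_eq0 => /andP[/eqP].
Qed.

Lemma psd_diag_blocks_eq0 m k (W : 'M[C]_(m + k)) :
  psd W -> ulsubmx W = 0 -> drsubmx W = 0 -> W = 0.
Proof.
move=> Wp ul0 dr0; apply: (psd_trace_eq0 Wp).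
by rewrite -(submxK W) mxtrace_block ul0 dr0 !mxtrace0 addr0.
Qed.

End InnerProduct.

(** * Separation from the image of the cone *)

Section Coordinates.
Context {R : realType}.
Notation C := R[i].

(** A Hermitian matrix is encoded by a single real matrix, whose symmetric
   part gives the real parts and whose antisymmetric part gives the imaginary
   parts; every real vector is then a code, so that compactness can be taken
   from real row vectors. *)
Definition herm_of m (v : 'rV[R]_(m * m)) : 'M[C]_m :=
  \matrix_(i, j) ((vec_mx v i j + vec_mx v j i)
                  +i* (vec_mx v i j - vec_mx v j i)).

Lemma herm_of_herm m (v : 'rV[R]_(m * m)) : herm_of v \is hermsymmx.
Proof.
apply/hermP/matrixP => i j; rewrite !mxE; apply/eqP.
by rewrite eq_complex /= addrC eqxx opprB eqxx.
Qed.

Lemma herm_of_linear m a (u v : 'rV[R]_(m * m)) :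
  herm_of (a *: u + v) = a%:C *: herm_of u + herm_of v.
Proof.
apply/matrixP => i j; rewrite !mxE; apply/eqP.
by rewrite eq_complex /=; apply/andP; split; apply/eqP; ring.
Qed.

Lemma herm_of_coord m (v : 'rV[R]_(m * m)) i j :
  2 * vec_mx v i j =
  complex.Re (herm_of v i j) + complex.Im (herm_of v i j).
Proof. by rewrite !mxE /=; ring. Qed.

Lemma herm_of_onto m (N : 'M[C]_m) : N \is hermsymmx ->
  exists v, herm_of v = N.
Proof.
move=> /hermP/matrixP Nh.
exists (mxvec (\matrix_(i, j) ((complex.Re (N i j) + complex.Im (N i j)) / 2))).
apply/matrixP => i j; rewrite /herm_of mxvecK !mxE.
have := Nh i j; rewrite !mxE; case: (N i j) (N j i) => [a b] [c e] /= [<- <-].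
by apply/eqP; rewrite eq_complex /=; apply/andP; split; apply/eqP; field.
Qed.

(** The entries of a positive semidefinite matrix [N = B^2] are inner products
   of columns of [B], whose squared norms are the diagonal entries of [N]. *)
Lemma psd_coord_le m (v : 'rV[R]_(m * m)) k :
  psd (herm_of v) -> `|v 0 k| <= complex.Re (\tr (herm_of v)).
Proof.
move=> Np; have diag_le i : complex.Re (herm_of v i i) <=
    complex.Re (\tr (herm_of v)).
  rewrite /mxtrace Re_sum (bigD1 i) //= lerDl sumr_ge0 // => j _.
  exact/Re_ge0/psd_diag_ge0.
have [i [j ->]] : exists i j, v 0 k = vec_mx v i j.
  case/mxvec_indexP: k => i j; exists i, j.
  by rewrite -[in LHS](vec_mxK v) mxvecE.
suff : `|2 * vec_mx v i j| <= complex.Re (herm_of v i i) +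
    complex.Re (herm_of v j j).
  by rewrite normrM ger0_norm //; have := diag_le i; have := diag_le j; lra.
rewrite herm_of_coord -(sqrtmxK Np) -{1 3 5 7}(sqrtmx_herm Np).
move: (sqrtmx _) => B; rewrite !mxE !Re_sum Im_sum -!big_split /=.
apply: le_trans (ler_norm_sum _ _ _) _; apply: ler_sum => l _; rewrite !mxE.
case: (B l i) (B l j) => [a b] [c e] /=; rewrite !mulNr !opprK ler_norml.
have := sqr_ge0 (a - (c + e) / 2); have := sqr_ge0 (b - (e - c) / 2).
have := sqr_ge0 (a + (c + e) / 2); have := sqr_ge0 (b + (e - c) / 2).
have := sqr_ge0 c; have := sqr_ge0 e; rewrite !expr2 => *.
by apply/andP; split; lra.
Qed.

End Coordinates.

Section Continuity.
Import numFieldNormedType.Exports.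
Context {R : realType}.
Notation C := R[i].

Lemma continuous_addf (T : topologicalType) (f g : T -> R) :
  continuous f -> continuous g -> continuous (fun x => f x + g x).
Proof. by move=> fc gc x; apply: cvgD; [exact: fc | exact: gc]. Qed.

Lemma continuous_mulf (T : topologicalType) (f g : T -> R) :
  continuous f -> continuous g -> continuous (fun x => f x * g x).
Proof. by move=> fc gc x; apply: cvgM; [exact: fc | exact: gc]. Qed.

Lemma continuous_sum (T : topologicalType) (I : Type) (r : seq I)
    (F : I -> T -> R) : (forall i, continuous (F i)) ->
  continuous (fun x => \sum_(i <- r) F i x).
Proof.
move=> Fc; elim: r => [|i r IH].
  by under eq_fun do rewrite big_nil; exact: cst_continuous.
have -> : (fun y => \sum_(j <- i :: r) F j y) =
    (fun y => F i y + \sum_(j <- r) F j y).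
  by apply/funext => y; rewrite big_cons.
exact: continuous_addf.
Qed.

Lemma linear_form_continuous N (f : 'rV[R]_N -> R) :
  (forall a u v, f (a *: u + v) = a * f u + f v) -> continuous f.
Proof.
move=> fL; have f0 : f 0 = 0.
  by have := fL (-1) 0 0; rewrite scaler0 addr0 mulN1r addNr.
have -> : f = (fun v => \sum_j v 0 j * f (delta_mx 0 j)).
  apply/funext => v; rewrite [in LHS](row_sum_delta v).
  elim/big_rec2: _ => // j x y _ <-; exact: fL.
apply: continuous_sum => j; apply: continuous_mulf.
  exact: coord_continuous.
exact: cst_continuous.
Qed.

(** The cone is an intersection of closed half-spaces, one for each test
   vector, and bounding the trace bounds every coordinate. *)
Lemma psd_slice_compact m (a b : R) :
  compact [set v : 'rV[R]_(m * m) | psd (herm_of v) /\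
     a <= complex.Re (\tr (herm_of v)) <= b].
Proof.
have trc : continuous (fun v : 'rV[R]_(m * m) => complex.Re (\tr (herm_of v))).
  apply: linear_form_continuous => c x y.
  by rewrite herm_of_linear mxtraceD mxtraceZ ReD ReZ.
apply: bounded_closed_compact.
  exists (Num.max b 0); split; first exact: num_real.
  move=> M bM v /= [vp /andP[_ trb]].
  rewrite [leLHS]/Num.norm /= mx_normrE; apply: bigmax_le => [|[i j] _ /=].
    by apply: le_trans (ltW bM); rewrite le_max lexx orbT.
  rewrite (ord1 i); apply: le_trans (psd_coord_le j vp) _.
  by apply: le_trans trb _; apply: le_trans (ltW bM); rewrite le_max lexx.
rewrite (_ : [set v | _] =
   \bigcap_(x in [set: 'cV[C]_m])
     [set v | 0 <= complex.Re ((x^t* *m herm_of v *m x) 0 0)]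
   `&` ([set v | a <= complex.Re (\tr (herm_of v))]
   `&` [set v | complex.Re (\tr (herm_of v)) <= b])); last first.
  apply/seteqP; split=> v /=.
    by move=> [[_ vp] /andP[]]; split=> // x _; exact/Re_ge0/vp.
  move=> [vp [-> ->]]; split=> //; apply: psdE => [|x]; last exact: vp.
  exact: herm_of_herm.
apply: closedI; last first.
  apply: closedI.
    exact: (@preimage_closed _ _ _ [set y : R | a <= y] (in1W trc)
      (@closed_ge _ a)).
  exact: (@preimage_closed _ _ _ [set y : R | y <= b] (in1W trc)
    (@closed_le _ b)).
apply: closed_bigI => x _.
apply: (@preimage_closed _ _
  (fun v => complex.Re ((x^t* *m herm_of v *m x) 0 0))
  [set y : R | 0 <= y]); last exact: closed_ge.
apply: in1W; apply: linear_form_continuous => c y z.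
by rewrite herm_of_linear mulmxDr mulmxDl -scalemxAr -scalemxAl !mxE ReD ReZ.
Qed.

(** First-order optimality: at the left end of the segment the quadratic term
   is negligible against the slope. *)
Lemma quad_nonneg_slope (a b : R) :
  (forall t, 0 < t -> t <= 1 -> 0 <= 2 * t * a + t ^+ 2 * b) -> 0 <= a.
Proof.
move=> h; rewrite leNgt; apply/negP => a0.
have c0 : 0 < `|b| - a by rewrite ltr_wpDl // oppr_gt0.
(* Small enough for [t * b <= - a], which leaves the slope in control. *)
pose t := - a / (`|b| - a); have t0 : 0 < t by rewrite divr_gt0 ?oppr_gt0.
have t1 : t <= 1 by rewrite ler_pdivrMr // mul1r lerDr.
have := h t t0 t1.
have -> : 2 * t * a + t ^+ 2 * b = t * (2 * a + t * b) by ring.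
rewrite pmulr_rge0 //; have tb : t * b <= - a.
  have [b0|b0] := leP b 0.
    have tb0 : t * b <= 0 by rewrite pmulr_rle0.
    by rewrite (le_trans tb0) // oppr_ge0 ltW.
  have -> : t * b = - a * (b / (`|b| - a)) by rewrite /t; field; rewrite gt_eqF.
  have : b / (`|b| - a) <= 1.
    by rewrite ler_pdivrMr // mul1r gtr0_norm // lerDl oppr_ge0 ltW.
  by apply: ler_piMr; rewrite oppr_ge0 ltW.
by lra.
Qed.

End Continuity.

Section ClosedImage.
Import numFieldNormedType.Exports.
Context {R : realType} {m q : nat}.
Notation C := R[i].
Variable L : 'M[C]_m -> 'M[C]_q.
Hypothesis L_linear :
  forall (a : R) X Y, L (a%:C *: X + Y) = a%:C *: L X + L Y.

Lemma L_zero : L 0 = 0.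
Proof.
have := L_linear (-1) 0 0; rewrite scaler0 addr0 => {1}->.
by rewrite rmorphN1 scaleN1r addNr.
Qed.

Lemma L_scale (a : R) X : L (a%:C *: X) = a%:C *: L X.
Proof. by have := L_linear a X 0; rewrite !addr0 L_zero addr0. Qed.

Lemma dist_continuous (p : 'M[C]_q) :
  continuous (fun v => ipmx (L (herm_of v) - p) (L (herm_of v) - p)).
Proof.
under eq_fun do rewrite ipmxE.
apply: continuous_sum => i; apply: continuous_sum => j.
have Rc : continuous (fun v => complex.Re ((L (herm_of v) - p) i j)).
  under eq_fun do rewrite !mxE ReD.
  apply: continuous_addf; last exact: cst_continuous.
  apply: linear_form_continuous => a x y.
  by rewrite herm_of_linear L_linear !mxE ReD ReZ.
have Ic : continuous (fun v => complex.Im ((L (herm_of v) - p) i j)).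
  under eq_fun do rewrite !mxE ImD.
  apply: continuous_addf; last exact: cst_continuous.
  apply: linear_form_continuous => a x y.
  by rewrite herm_of_linear L_linear !mxE ImD ImZ.
by apply: continuous_addf; apply: continuous_mulf.
Qed.

Lemma dist_min_slice (p : 'M[C]_q) (a b : R) (N1 : 'M[C]_m) :
    psd N1 -> a <= complex.Re (\tr N1) <= b ->
  exists N0, [/\ psd N0, a <= complex.Re (\tr N0) <= b &
    forall N, psd N -> a <= complex.Re (\tr N) <= b ->
      ipmx (L N0 - p) (L N0 - p) <= ipmx (L N - p) (L N - p)].
Proof.
move=> N1p N1t.
have [v1 v1E] : exists v, herm_of v = N1 by apply: herm_of_onto; case: N1p.
have A0 : [set v : 'rV[R]_(m * m) | psd (herm_of v) /\
     a <= complex.Re (\tr (herm_of v)) <= b] !=set0.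
  by exists v1; rewrite /= v1E.
have [] := EVT_min_rV A0 (@psd_slice_compact _ m a b)
  (continuous_subspaceT (@dist_continuous p)).
move=> v0; rewrite inE /= => -[v0p v0t] v0min; exists (herm_of v0); split=> //.
move=> N Np Nt; have [v vE] : exists v, herm_of v = N.
  by apply: herm_of_onto; case: Np.
by have := v0min v; rewrite inE /= vE; apply.
Qed.

Hypothesis L_ker : forall N, psd N -> L N = 0 -> N = 0.

(** On the compact slice of trace one, the squared norm of [L] has a minimum,
   positive because [L] kills no nonzero matrix of the cone; homogeneity does
   the rest. *)
Lemma L_coercive : exists2 e, 0 < e &
  forall N, psd N -> e * complex.Re (\tr N) ^+ 2 <= ipmx (L N) (L N).
Proof.
have [[N1 [N1p N1t]]|noN] :=
  pselect (exists N1 : 'M[C]_m, psd N1 /\ complex.Re (\tr N1) = 1).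
  have [|N0 [N0p N0t N0min]] := @dist_min_slice 0 1 1 N1 N1p.
    by rewrite N1t lexx.
  have N0tr : complex.Re (\tr N0) = 1.
    by apply/eqP; rewrite eq_le andbC.
  exists (ipmx (L N0) (L N0)).
    rewrite lt_def ipmx_ge0 andbT; apply/eqP => /ipmx_eq0/(L_ker N0p) N00.
    by move: N0tr; rewrite N00 mxtrace0 => /esym/eqP; rewrite oner_eq0.
  move=> N Np; have tr0 := psd_trace_ge0 Np.
  have [t0|tn0] := eqVneq (complex.Re (\tr N)) 0.
    by rewrite t0 expr0n /= mulr0 ipmx_ge0.
  set t := complex.Re (\tr N) in tr0 tn0 *.
  have NE : N = t%:C *: (t^-1%:C *: N).
    by rewrite scalerA -rmorphM divff // scale1r.
  have := N0min (t^-1%:C *: N); rewrite !subr0 mxtraceZ ReZ -/t mulVf // lexx.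
  move=> /(_ (psdZ _ Np) isT); rewrite invr_ge0 => /(_ tr0).
  rewrite L_scale ipmxZl ipmxZr mulrA => le.
  have t2 : 0 < t ^+ 2 by rewrite exprn_gt0 // lt_def tn0.
  by rewrite -ler_pdivlMr // mulrC -exprVn expr2.
(* Without a matrix of trace one, rescaling shows that every trace vanishes. *)
exists 1 => // N Np; rewrite mul1r.
have tr0 := psd_trace_ge0 Np.
have [t0|tn0] := eqVneq (complex.Re (\tr N)) 0.
  by rewrite t0 expr0n /= ipmx_ge0.
case: noN; exists ((complex.Re (\tr N))^-1%:C *: N); split.
  by apply: psdZ; rewrite ?invr_ge0.
by rewrite mxtraceZ ReZ mulVf.
Qed.

(** By coercivity, matrices of large trace have an image farther from [p] than
   the image [0] of the zero matrix, so that the minimization takes place on a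
   compact slice. *)
Lemma nearest_image_point (p : 'M[C]_q) : exists2 N0, psd N0 &
  forall N, psd N ->
    ipmx (L N0 - p) (L N0 - p) <= ipmx (L N - p) (L N - p).
Proof.
have [e e0 coer] := L_coercive.
pose K := ipmx p p; have K0 : 0 <= K by exact: ipmx_ge0.
(* For a trace [t >= b], [e * t^2 >= e * (b - 1) = 4 * |p|^2], hence
   [|L N| >= 2 * |p|], which puts [L N] at least as far from [p] as [0]. *)
pose b := (4 * K / e) + 1.
have b1 : 1 <= b by rewrite lerDr divr_ge0 ?mulr_ge0 // ltW.
have [||N0 [N0p N0t N0min]] := @dist_min_slice p 0 b 0.
- exact: psd0.
- by rewrite mxtrace0 lexx (le_trans ler01).
exists N0 => // N Np; have tr0 := psd_trace_ge0 Np.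
have [tb|tb] := leP (complex.Re (\tr N)) b; first by apply: N0min; rewrite ?tr0.
apply: (@le_trans _ _ K).
  have := N0min 0 (psd0 _).
  rewrite mxtrace0 lexx (le_trans ler01) // L_zero sub0r.
  by rewrite ipmxNl ipmxNr opprK; apply.
have LN : 4 * K <= ipmx (L N) (L N).
  apply: le_trans (coer N Np).
  have -> : 4 * K = e * (b - 1).
    by rewrite /b addrK mulrCA divff ?mulr1 // gt_eqF.
  rewrite ler_pM2l // (le_trans (y := complex.Re (\tr N))) //; first by lra.
  by rewrite expr2 ler_peMl // (le_trans b1 (ltW tb)).
have := ipmx_ge0 (L N - 2%:C *: p).
rewrite -/K !(ipmxDl, ipmxDr, ipmxNl, ipmxNr, ipmxZl, ipmxZr) -/K (ipmxC p).
by lra.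
Qed.

(** The separation theorem behind both attainment results. The residual at the
   nearest point is nonnegative on the image of the cone (add small multiples
   of [N] to [N0]) and orthogonal to the nearest point (rescale [N0] both
   ways). Hence either [p] is in the image or the residual [r] separates:
   [ipmx r p] is then [- ipmx r r], which is negative. *)
Theorem closed_image_separation (p : 'M[C]_q) :
  exists N0, [/\ psd N0, ipmx (L N0 - p) (L N0) = 0 &
    forall N, psd N -> 0 <= ipmx (L N0 - p) (L N)].
Proof.
have [N0 N0p N0min] := nearest_image_point p.
have step (N : 'M[C]_m) (t : R) : psd (t%:C *: N + N0) ->
    0 <= 2 * t * ipmx (L N0 - p) (L N) + t ^+ 2 * ipmx (L N) (L N).
  move=> /N0min; rewrite L_linear -addrA.
  move: (L N0 - p) (L N) => r l.
  rewrite !(ipmxDl, ipmxDr, ipmxZl, ipmxZr) (ipmxC l r).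
  by rewrite expr2; lra.
have pos N : psd N -> 0 <= ipmx (L N0 - p) (L N).
  move=> Np; apply: (@quad_nonneg_slope _ _ (ipmx (L N) (L N))) => t t0 _.
  exact/step/psdD/N0p/psdZ/Np/ltW.
exists N0; split=> //; apply/eqP; rewrite eq_le pos // andbT -oppr_ge0.
apply: (@quad_nonneg_slope _ _ (ipmx (L N0) (L N0))) => t t0 t1.
(* Shrinking [N0] by the factor [1 - t] stays in the cone. *)
have := step N0 (- t); rewrite sqrrN mulrN mulNr mulrN; apply.
rewrite -[X in _ + X]scale1r -scalerDl -(rmorph1 (real_complex R)) -rmorphD.
by apply: psdZ => //; lra.
Qed.

End ClosedImage.

(** * Schur complements and Lehner's formula *)

Section LargestEigenvalue.
Context {R : realType}.
Notation C := R[i].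

Lemma herm_spectral n (M : 'M[C]_n) : M \is hermsymmx ->
  M = (spectralmx M)^t* *m diag_mx (spectral_diag M) *m spectralmx M.
Proof.
move=> /hermitian_normalmx/orthomx_spectralP {1}->.
by rewrite (invmx_unitary (spectral_unitarymx M)).
Qed.

Lemma psd_diag_mx n (e : 'rV[C]_n) : (forall i, 0 <= e 0 i) -> psd (diag_mx e).
Proof.
move=> e0; split=> [|x].
  apply/hermP; rewrite tr_diag_mx map_diag_mx; congr diag_mx.
  by apply/rowP => i; rewrite !mxE; apply/CrealP/ger0_real.
rewrite mul_mx_diag mxE sumr_ge0 // => i _; rewrite !mxE.
by rewrite mulrAC mulr_ge0 // mulrC mul_conjC_ge0.
Qed.

Lemma spectral_diag_eigenvalue n (M : 'M[C]_n) i : M \is hermsymmx ->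
  eigenvalue M (complex.Re (spectral_diag M 0 i))%:C.
Proof.
move=> Mh; have Vu := spectral_unitarymx M.
have /mxOverP/(_ 0 i) lr := hermitian_spectral_diag_real Mh.
apply/eigenvalueP; exists (row i (spectralmx M)); last first.
  apply/eqP => r0; have /(congr1 (row i)) := mulmxV (spectral_unit M).
  rewrite row_mul r0 mul0mx => /rowP/(_ i); rewrite !mxE eqxx.
  by move/eqP; rewrite eq_sym oner_eq0.
rewrite -row_mul {2}(herm_spectral Mh) !mulmxA (elimT unitarymxP Vu) mul1mx.
by rewrite RRe_real // row_mul row_diag_mx -scalemxAl -rowE.
Qed.

Lemma psd_shift n (M : 'M[C]_n) (c : R) : M \is hermsymmx ->
  (forall i, complex.Re (spectral_diag M 0 i) <= c) -> psd (c%:C%:M - M).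
Proof.
move=> Mh lec; rewrite {1}(herm_spectral Mh).
have Vu := spectral_unitarymx M.
have -> : (c%:C%:M : 'M[C]_n) =
    (spectralmx M)^t* *m c%:C%:M *m spectralmx M.
  rewrite mul_mx_scalar -scalemxAl -(invmx_unitary Vu) mulVmx ?spectral_unit //.
  by rewrite scalemx1.
rewrite -mulmxBl -mulmxBr; apply: psd_congr.
have -> : c%:C%:M - diag_mx (spectral_diag M) =
    diag_mx (const_mx c%:C - spectral_diag M).
  by rewrite -diag_const_mx -linearB.
apply: psd_diag_mx => i; rewrite !mxE subr_ge0.
have /mxOverP/(_ 0 i) lr := hermitian_spectral_diag_real Mh.
by rewrite -(RRe_real lr) lecR.
Qed.

Lemma eigenvalue_le n (M : 'M[C]_n) (c x : R) :
  psd (c%:C%:M - M) -> eigenvalue M x%:C -> x <= c.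
Proof.
move=> [_ cM] /eigenvalueP[v vM v0].
have := cM (v^t*); rewrite trmxCK mulmxBr vM mul_mx_scalar -scalerBl -scalemxAl.
rewrite mxE -rmorphB /= pmulr_lge0 ?ler0c ?subr_ge0 //.
rewrite -{1}(trmxCK v) lt_def mulCx_ge0 andbT; apply: contra v0.
by move=> /eqP/mulCx_eq0 /(congr1 (fun w => w^t*)); rewrite trmxCK ctr0 => ->.
Qed.

Lemma has_sup_eigenvalues n (M : 'M[C]_n) : (0 < n)%N -> M \is hermsymmx ->
  has_sup [set x : R | eigenvalue M x%:C].
Proof.
move=> n0 Mh; split.
  by exists (complex.Re (spectral_diag M 0 (Ordinal n0)));
    exact: spectral_diag_eigenvalue.
exists (\sum_i `|complex.Re (spectral_diag M 0 i)|) => x /=.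
apply: eigenvalue_le; apply: psd_shift => // i.
by rewrite (bigD1 i) //= (le_trans (ler_norm _)) // lerDl sumr_ge0.
Qed.

Lemma lambda_max_psd n (M : 'M[C]_n) : (0 < n)%N -> M \is hermsymmx ->
  psd ((lambda_max M)%:C%:M - M).
Proof.
move=> n0 Mh; apply: psd_shift => // i.
apply: sup_upper_bound; first exact: has_sup_eigenvalues.
exact: spectral_diag_eigenvalue.
Qed.

Lemma lambda_max_le n (M : 'M[C]_n) (c : R) : (0 < n)%N -> M \is hermsymmx ->
  psd (c%:C%:M - M) -> lambda_max M <= c.
Proof.
move=> n0 Mh cM; apply: ge_sup; first by case: (has_sup_eigenvalues n0 Mh).
by move=> x /=; exact: eigenvalue_le.
Qed.

End LargestEigenvalue.

Section SchurComplement.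
Context {R : realType}.
Notation C := R[i].

(** The off-diagonal identity makes [Z] definite: it maps the kernel of [Z] to
   zero. Block elimination does the rest. *)
Lemma schur_complement n (B Z : 'M[C]_n) :
  psd (block_mx B 1%:M 1%:M Z) <-> posdef Z /\ psd (B - invmx Z).
Proof.
split=> [Wp|[Zp Bp]].
  have Zp : posdef Z.
    apply: psd_posdef => [|x Zx]; first exact: psd_block_dr Wp.
    by have := psd_block_dr0 Wp Zx; rewrite mul1mx.
  split=> //; have Zu := posdef_unit Zp.
  have [/hermP Zih _] := posdef_inv Zp.
  have := psd_congr (col_mx 1%:M (- invmx Z)) Wp.
  rewrite ctr_col ctr1 ctrN Zih mul_row_block mul_row_col !mul1mx !mulmx1.
  rewrite mulNmx (mulVmx Zu) (subrr 1%:M) mul0mx addr0; exact.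
have Zu := posdef_unit Zp.
have [/hermP Zih _] := posdef_inv Zp.
have -> : block_mx B 1%:M 1%:M Z = block_mx (B - invmx Z) 0 0 0 +
    (row_mx (invmx Z) 1%:M)^t* *m Z *m row_mx (invmx Z) 1%:M.
  rewrite ctr_row ctr1 Zih -mulmxA mul_mx_row mul_col_row (mulmxV Zu) !mulmx1.
  by rewrite !mul1mx (mulVmx Zu) add_block_mx !add0r subrK.
apply: psdD; first exact: psd_blockD (psd0 _).
exact/psd_congr/posdef_psd.
Qed.

End SchurComplement.

Section Map.
Context {R : realType} {d n : nat}.
Notation C := R[i].
Variable A : 'I_n -> 'M[C]_d.

Lemma Phi_linear (a : C) X Y : Phi A (a *: X + Y) = a *: Phi A X + Phi A Y.
Proof.
rewrite /Phi scaler_sumr -big_split; apply: eq_bigr => i _ /=.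
by rewrite mulmxDr mulmxDl -scalemxAr -scalemxAl.
Qed.

Lemma Phi0 : Phi A 0 = 0.
Proof. by rewrite /Phi big1 // => i _; rewrite mulmx0 mul0mx. Qed.

Lemma PhiZ (a : C) X : Phi A (a *: X) = a *: Phi A X.
Proof. by rewrite -[a *: X]addr0 Phi_linear Phi0 !addr0. Qed.

Hypothesis A_herm : forall i, A i \is hermsymmx.

Let A_ctr i : (A i)^t* = A i. Proof. exact/hermP. Qed.

Lemma Phi_psd X : psd X -> psd (Phi A X).
Proof.
by move=> Xp; apply: psd_sum => i; rewrite -{1}A_ctr; apply: psd_congr.
Qed.

Lemma Phi_ctr X : (Phi A X)^t* = Phi A (X^t*).
Proof.
rewrite /Phi raddf_sum /= map_mx_sum.
by apply: eq_bigr => i _; rewrite !ctrM !A_ctr mulmxA.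
Qed.

Lemma Phi_herm X : X \is hermsymmx -> Phi A X \is hermsymmx.
Proof. by move=> /hermP Xh; apply/hermP; rewrite Phi_ctr Xh. Qed.

Lemma ipmx_Phi X Y : ipmx (Phi A X) Y = ipmx X (Phi A Y).
Proof.
rewrite /ipmx Phi_ctr /Phi mulmx_suml mulmx_sumr; congr complex.Re.
rewrite !raddf_sum; apply: eq_bigr => i _ /=.
by rewrite -!mulmxA mxtrace_mulC !mulmxA.
Qed.

End Map.

Section Lehner.
Context {R : realType} {d n : nat}.
Notation C := R[i].
Variables (A0 : 'M[C]_d) (A : 'I_n -> 'M[C]_d).
Hypotheses (d_gt0 : (0 < d)%N) (A0_herm : A0 \is hermsymmx)
  (A_herm : forall i, A i \is hermsymmx).

Let opprD_rot (c z a p : 'M[C]_d) : c - (z + a + p) = c - a - p - z.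
Proof. by rewrite [z + a]addrC -addrA [z + p]addrC addrA !opprD !addrA. Qed.

Let lehner_mx Z := Z + A0 + Phi A (invmx Z).

Lemma lehner_mx_herm Z : posdef Z -> lehner_mx Z \is hermsymmx.
Proof.
move=> Zp; have [Zih _] := posdef_inv Zp; have [Zh _] := Zp.
by apply: hermD (Phi_herm A_herm Zih); apply: hermD.
Qed.

Lemma lehner_feasible Z : posdef Z ->
  feasible (probP A0 A) (lehner A0 A Z, invmx Z).
Proof.
move=> Zp; have Zip := posdef_inv Zp; apply/feasibleP; split.
  by case: Zip.
apply/schur_complement; split=> //; rewrite invmxK.
have := lambda_max_psd d_gt0 (lehner_mx_herm Zp).
rewrite -[lambda_max _]/(lehner A0 A Z) /lehner_mx.
by rewrite opprD_rot.
Qed.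

Lemma feasible_lehner c Z : feasible (probP A0 A) (c, Z) ->
  posdef (invmx Z) /\ lehner A0 A (invmx Z) <= c.
Proof.
move=> /feasibleP[Zh /schur_complement[Zp Bp]]; split; first exact: posdef_inv.
apply: (lambda_max_le d_gt0); first exact: lehner_mx_herm (posdef_inv Zp).
move: Bp; rewrite /lehner_mx invmxK.
by rewrite opprD_rot.
Qed.

(** For fixed [Z], the Schur complement of the constraint of (P) says that [c]
   bounds the matrix of Lehner's formula at [Z^-1]. *)
Lemma inf_probP : inf_val (feasible (probP A0 A)) (sdp_obj (probP A0 A))
  = Lambda_sc A0 A.
Proof.
apply/eqP; rewrite eq_le; apply/andP; split.
  apply: le_ereal_inf_tmp => _ [Z Zp <-]; apply: ereal_inf_lbound.
  by exists (lehner A0 A Z, invmx Z) => //; exact: lehner_feasible.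
apply: le_ereal_inf_tmp => _ [[c Z] /feasible_lehner[Zp le_c] <-].
apply: le_trans (_ : (lehner A0 A (invmx Z))%:E <= _)%E; last first.
  by rewrite lee_fin.
by apply: ereal_inf_lbound; exists (invmx Z).
Qed.

End Lehner.

(** * Polar decomposition and the off-diagonal block *)

Section Polar.
Context {R : realType}.
Notation C := R[i].

Lemma spectral_diag_ge0 n (H : 'M[C]_n) i : psd H -> 0 <= spectral_diag H 0 i.
Proof.
move=> Hp; have Vu := spectral_unitarymx H.
have := psd_diag_ge0 i (psd_congr ((spectralmx H)^t*) Hp).
rewrite trmxCK {2}(herm_spectral Hp.1) !mulmxA (elimT unitarymxP Vu) mul1mx.
by rewrite -mulmxA (elimT unitarymxP Vu) mulmx1 mxE eqxx.
Qed.

Lemma conj_diag_mul n (V : 'M[C]_n) (a b : 'rV[C]_n) : V \is unitarymx ->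
  (V^t* *m diag_mx a *m V) *m (V^t* *m diag_mx b *m V) =
  V^t* *m diag_mx (\row_i (a 0 i * b 0 i)) *m V.
Proof.
move=> Vu; rewrite -!mulmxA (mulmxA V) (elimT unitarymxP Vu) mul1mx.
by rewrite (mulmxA (diag_mx a)) mulmx_diag.
Qed.

Lemma mul_ctr_eq0 m n (M : 'M[C]_(m, n)) : M *m M^t* = 0 -> M = 0.
Proof.
move=> M0; apply/row_matrixP => i; rewrite row0.
have : (row i M)^t* = 0.
  apply: mulCx_eq0; rewrite trmxCK.
  have -> : row i M *m (row i M)^t* =
      row i (M *m M^t* *m (delta_mx i 0 : 'cV_m)).
    rewrite -mulmxA row_mul; congr (_ *m _); rewrite rowE ctrM; congr (_ *m _).
    by rewrite trmx_delta map_delta_mx.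
  by rewrite M0 mul0mx row0 mxE.
by move=> /(congr1 (fun w => w^t*)); rewrite trmxCK ctr0.
Qed.

Lemma sqrtmx_diag n (H : 'M[C]_n) : psd H ->
  exists V : 'M[C]_n, exists2 s : 'rV[C]_n, V \is unitarymx &
    (forall i, 0 <= s 0 i) /\ sqrtmx H = V^t* *m diag_mx s *m V.
Proof.
move=> Hp; have Vu := spectral_unitarymx H.
exists (spectralmx H), (map_mx sqrtC (spectral_diag H)) => //; split=> [i|].
  by rewrite mxE sqrtC_ge0 spectral_diag_ge0.
by rewrite /sqrtmx (invmx_unitary Vu).
Qed.

(** With [Q] the pseudo-inverse of [P], obtained by inverting the nonzero
   eigenvalues, [K := Q *m Y] works: [P *m Q] is the projection onto the range
   of [P], which is that of [Y], and [K *m K^t*] is this projection. *)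
Lemma polar_decomposition m n (Y : 'M[C]_(m, n)) :
  exists K : 'M[C]_(m, n), let P := sqrtmx (Y *m Y^t*) in
  [/\ Y = P *m K, K *m Y^t* = P & psd (1%:M - K *m K^t*)].
Proof.
have Hp : psd (Y *m Y^t*) by rewrite -{1}(trmxCK Y); exact: psd_gram.
have [V [s Vu [s0 PE]]] := sqrtmx_diag Hp.
have VV : V^t* *m V = 1%:M.
  by rewrite -(invmx_unitary Vu) mulVmx // unitarymx_unit.
(* Since [0^-1 = 0], this is the spectrum of the pseudo-inverse. *)
pose t : 'rV[C]_m := \row_i (s 0 i)^-1.
have sts i : s 0 i * t 0 i * s 0 i = s 0 i.
  rewrite mxE; have [->|sn0] := eqVneq (s 0 i) 0; first by rewrite mulr0.
  by rewrite divff // mul1r.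
have tst i : t 0 i * s 0 i * t 0 i = t 0 i.
  rewrite mxE; have [->|sn0] := eqVneq (s 0 i) 0.
    by rewrite mulr0 mul0r invr0.
  by rewrite mulVf // mul1r.
have ts_le1 i : t 0 i * s 0 i <= 1.
  rewrite mxE; have [->|sn0] := eqVneq (s 0 i) 0; first by rewrite mulr0 ler01.
  by rewrite mulVf.
have t0 i : 0 <= t 0 i by rewrite mxE invr_ge0.
move: t t0 sts tst ts_le1 => t t0 sts tst ts_le1.
have PP := sqrtmxK Hp; move: (sqrtmx _) PE PP => P PE PP /=.
pose Q := V^t* *m diag_mx t *m V.
have Qh : Q^t* = Q by apply/hermP/herm_congr; case: (psd_diag_mx t0).
have QPE : Q *m P = V^t* *m diag_mx (\row_i (t 0 i * s 0 i)) *m V.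
  by rewrite PE (conj_diag_mul _ _ Vu).
have QP : Q *m P = P *m Q.
  rewrite QPE PE (conj_diag_mul _ _ Vu); congr (_ *m diag_mx _ *m _).
  by apply/rowP => i; rewrite !mxE mulrC.
have QPP : Q *m P *m P = P.
  rewrite QPE PE (conj_diag_mul _ _ Vu); congr (_ *m diag_mx _ *m _).
  by apply/rowP => i; rewrite !mxE (mulrC (t 0 i)).
have QPQ : Q *m P *m Q = Q.
  rewrite QPE (conj_diag_mul _ _ Vu); congr (_ *m diag_mx _ *m _).
  by apply/rowP => i; rewrite !mxE.
exists (Q *m Y); split.
- apply/eqP; rewrite -subr_eq0; apply/eqP/mul_ctr_eq0.
  rewrite mulmxA -{1 3}[Y]mul1mx -mulmxBl ctrM mulmxA -(mulmxA _ Y) -PP.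
  by rewrite (mulmxA _ P P) mulmxBl mul1mx -QP QPP subrr !mul0mx.
- by rewrite -mulmxA -PP mulmxA QPP.
- rewrite ctrM Qh mulmxA -(mulmxA Q) -PP (mulmxA Q) -(mulmxA _ P) -QP mulmxA.
  rewrite QPQ QPE -VV -{1}[V^t*]mulmx1 -mulmxBl -mulmxBr.
  rewrite -diag_const_mx -linearB; apply/psd_congr/psd_diag_mx => i.
  by rewrite !mxE subr_ge0.
Qed.

Lemma mxtrace_contraction m n (K : 'M[C]_(m, n)) k (Q : 'M[C]_(m, k)) :
  psd (1%:M - K *m K^t*) ->
  complex.Re (\tr ((K^t* *m Q)^t* *m (K^t* *m Q))) <=
  complex.Re (\tr (Q^t* *m Q)).
Proof.
move=> /(psd_congr Q)/psd_trace_ge0; rewrite mulmxBr mulmxBl mulmx1.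
by rewrite linearB /= ReD ReN subr_ge0 ctrM trmxCK !mulmxA.
Qed.

(** The rows of the square root of the block matrix factor [- T] as
   [S^(1/2) K1 K2^t* U^(1/2)] with contractions [K1] and [K2]. Polar
   decomposition of [Y := S^(1/2) U^(1/2)] as [P *m K3] then makes the trace
   of [- T] that of a product of contractions against [P], at most the trace
   of [P] in modulus. *)
Lemma block_trace_le n (S T U : 'M[C]_n) :
  psd (block_mx S (- T) (- T^t*) U) ->
  complex.Re (\tr T) <= nuclear_norm (sqrtmx S *m sqrtmx U).
Proof.
set W := block_mx _ _ _ _ => Wp.
have Sp := psd_block_ul Wp; have Up := psd_block_dr Wp.
have := sqrtmxK Wp; rewrite -{2}(sqrtmx_herm Wp).
set B1 := usubmx (sqrtmx W); set B2 := dsubmx (sqrtmx W).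
rewrite -[sqrtmx W]vsubmxK -/B1 -/B2 ctr_col mul_col_row.
move=> /eq_block_mx[SE TE _ UE].
have [K1 /=] := polar_decomposition B1; rewrite SE => -[B1E _ K1c].
have [K2 /=] := polar_decomposition B2; rewrite UE => -[B2E _ K2c].
have Sh := sqrtmx_herm Sp; have Uh := sqrtmx_herm Up.
move: (sqrtmx S) (sqrtmx U) Sh Uh B1E B2E => s u Sh Uh B1E B2E.
have Hp : psd (s *m u *m (s *m u)^t*).
  by rewrite -{1}(trmxCK (s *m u)); exact: psd_gram.
have [K3 /= [YE _ K3c]] := polar_decomposition (s *m u).
have [Pp _] := sqrtmxP Hp; rewrite /nuclear_norm.
move: (sqrtmx _) Pp YE => P Pp YE; pose Q := sqrtmx P.
have Qh : Q^t* = Q := sqrtmx_herm Pp.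
have QQ : Q *m Q = P := sqrtmxK Pp.
move: Q Qh QQ => Q Qh QQ; have QQ' : Q^t* *m Q = P by rewrite Qh.
pose G1 := K1^t* *m Q; pose G2 := K2^t* *m (K3^t* *m Q).
have G1le : complex.Re (\tr (G1^t* *m G1)) <= complex.Re (\tr P).
  by rewrite -QQ'; exact: mxtrace_contraction K1c.
have G2le : complex.Re (\tr (G2^t* *m G2)) <= complex.Re (\tr P).
  apply: le_trans (mxtrace_contraction _ K2c) _.
  by rewrite -QQ'; exact: mxtrace_contraction K3c.
have us : u *m s = K3^t* *m Q *m Q.
  have /hermP Ph := Pp.1.
  by rewrite -(trmxCK (u *m s)) ctrM Uh Sh YE ctrM Ph -mulmxA QQ.
have TG : \tr (G1^t* *m G2) = - \tr T.
  rewrite -linearN /= -TE B1E B2E !ctrM Uh Qh trmxCK.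
  rewrite -!mulmxA [LHS]mxtrace_mulC [RHS]mxtrace_mulC -!mulmxA us.
  by rewrite -!mulmxA.
clearbody G1 G2; have := psd_trace_ge0 (psd_gram (G1 + G2)).
rewrite ctrD mulmxDl !mulmxDr !mxtraceD !ReD TG.
have -> : \tr (G2^t* *m G1) = ((\tr (G1^t* *m G2))^*)%R.
  by rewrite -mxtrace_ctr ctrM trmxCK.
by rewrite TG ReJ !ReN; lra.
Qed.

(** [T := S^(1/2) K U^(1/2)] with [K] the polar factor of [S^(1/2) U^(1/2)];
   the block matrix is congruent to the one with entries [1] and [- K], which
   is positive semidefinite because [K] is a contraction. *)
Lemma block_trace_attained n (S U : 'M[C]_n) : psd S -> psd U ->
  exists2 T : 'M[C]_n, psd (block_mx S (- T) (- T^t*) U) &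
    complex.Re (\tr T) = nuclear_norm (sqrtmx S *m sqrtmx U).
Proof.
move=> Sp Up; rewrite /nuclear_norm.
have Sh := sqrtmx_herm Sp; have Uh := sqrtmx_herm Up.
have SS := sqrtmxK Sp; have UU := sqrtmxK Up.
move: (sqrtmx S) (sqrtmx U) Sh Uh SS UU => s u Sh Uh SS UU.
have [K /= [_]] := polar_decomposition (s *m u).
move: (sqrtmx _) => P KY Kc; exists (s *m K *m u); last first.
  by rewrite -KY ctrM Sh Uh -mulmxA mxtrace_mulC -mulmxA.
have -> : block_mx S (- (s *m K *m u)) (- (s *m K *m u)^t*) U =
    (block_mx s 0 0 u)^t* *m
      (block_mx (1%:M - K *m K^t*) 0 0 0
       + (row_mx (- K^t*) 1%:M)^t* *m row_mx (- K^t*) 1%:M) *m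
    block_mx s 0 0 u.
  rewrite ctr_block !ctr0 Sh Uh ctr_row ctrN trmxCK ctr1 mul_col_row.
  rewrite add_block_mx !add0r mulNmx mulmxN opprK subrK !mul1mx mulmx1.
  rewrite !mulmx_block !(mul0mx, mulmx0) !addr0 !add0r !mulmx1 SS UU.
  by rewrite 2!(mulmxN, mulNmx) 2!(mulmxN, mulNmx) !ctrM Sh Uh mulmxA.
apply/psd_congr/psdD; last exact: psd_gram.
exact: psd_blockD (psd0 _).
Qed.

End Polar.

(** * Lagrangian duals *)

Section BoundedAffine.
Context {R : realType} {T : Type}.
Variables (X : set T) (f : T -> R).

Lemma inf_val_lb x0 : X x0 -> inf_val X f != -oo%E ->
  exists m, forall x, X x -> m <= f x.
Proof.
move=> Xx0; have lb x : X x -> (inf_val X f <= (f x)%:E)%E.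
  by move=> Xx; apply: ereal_inf_lbound; exists x.
case: (inf_val X f) lb => [r|/(_ _ Xx0)|] //= lb _.
by exists r => x /lb; rewrite lee_fin.
Qed.

Lemma sup_val_ub x0 : X x0 -> sup_val X f != +oo%E ->
  exists m, forall x, X x -> f x <= m.
Proof.
move=> Xx0; have ub x : X x -> ((f x)%:E <= sup_val X f)%E.
  by move=> Xx; apply: ereal_sup_ubound; exists x.
case: (sup_val X f) ub => [r||/(_ _ Xx0)] //= ub _.
by exists r => x /ub; rewrite lee_fin.
Qed.

(** A function that is affine along a full line and bounded below is constant
   on it; this is how the multipliers with a finite dual value are
   identified. *)
Lemma inf_val_slope (a b : R) (g : R -> T) : (forall t, X (g t)) ->
  (forall t, f (g t) = b + t * a) -> inf_val X f != -oo%E -> a = 0.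
Proof.
move=> Xg fg /(inf_val_lb (Xg 0))[m lem]; apply/eqP/negPn/negP => a0.
have := lem _ (Xg ((m - 1 - b) / a)); rewrite fg divfK //; lra.
Qed.

Lemma sup_val_slope (a b : R) (g : R -> T) : (forall t, X (g t)) ->
  (forall t, f (g t) = b + t * a) -> sup_val X f != +oo%E -> a = 0.
Proof.
move=> Xg fg /(sup_val_ub (Xg 0))[m lem]; apply/eqP/negPn/negP => a0.
have := lem _ (Xg ((m + 1 - b) / a)); rewrite fg divfK //; lra.
Qed.

Lemma inf_val_cst x0 c : X x0 -> (forall x, X x -> f x = c) ->
  inf_val X f = c%:E.
Proof.
move=> Xx0 fc; rewrite /inf_val [X in ereal_inf X](_ : _ = [set c%:E]).
  exact: ereal_inf1.
apply/seteqP; split=> [_ [x Xx <-] /=|_ ->]; first by rewrite fc.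
by exists x0 => //; rewrite fc.
Qed.

Lemma sup_val_cst x0 c : X x0 -> (forall x, X x -> f x = c) ->
  sup_val X f = c%:E.
Proof.
move=> Xx0 fc; rewrite /sup_val [X in ereal_sup X](_ : _ = [set c%:E]).
  exact: ereal_sup1.
apply/seteqP; split=> [_ [x Xx <-] /=|_ ->]; first by rewrite fc.
by exists x0 => //; rewrite fc.
Qed.

End BoundedAffine.

Section Lagrangians.
Context {R : realType} {d n : nat}.
Notation C := R[i].
Variables (A0 : 'M[C]_d) (A : 'I_n -> 'M[C]_d).
Hypotheses (A0_herm : A0 \is hermsymmx) (A_herm : forall i, A i \is hermsymmx).
Notation P := (probP A0 A).
Notation D := (probD A0 A).

Lemma ipmx_lmiP S Y U c Z :
  ipmx (block_mx S Y (Y^t*) U) (sdp_lmi P (c, Z)) =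
  c * complex.Re (\tr S) - ipmx A0 S + ipmx (U - Phi A S) Z
  + 2 * complex.Re (\tr Y).
Proof.
rewrite /= -{2}(ctr1 d) ipmx_block mulmx1 mxtrace_ctr ReJ.
rewrite !(ipmxDr, ipmxNr) ipmxDl ipmxNl ipmx_Phi //.
by rewrite (ipmxC S _%:M) ipmx_scalarl (ipmxC S A0); ring.
Qed.

Lemma ipmx_lmiD X Y Z S T :
  ipmx (block_mx X Y (Y^t*) Z) (sdp_lmi D (S, T)) =
  ipmx (X + Phi A Z) S - 2 * ipmx Y T.
Proof.
rewrite /= -ctrN ipmx_block mulmxN linearN ReN -ipmx_Phi // -/(ipmx Y T).
by rewrite ipmxDl; ring.
Qed.

(** The linear constraints on [S] and [T] make the slope in [(c, Z)] vanish. *)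
Lemma lagrangianP S T c Z :
  S \is hermsymmx -> \tr S = 1 ->
  c - ipmx (sdp_lmi D (S, T)) (sdp_lmi P (c, Z)) = sdp_obj D (S, T).
Proof.
move=> Sh St; rewrite [sdp_lmi D _]/= -ctrN ipmx_lmiP St subrr.
by rewrite (ipmxC 0) ipmx0r linearN ReN /=; ring.
Qed.

Lemma lagrangianD S T c Z : Z \is hermsymmx ->
  sdp_obj D (S, T) + ipmx (sdp_lmi P (c, Z)) (sdp_lmi D (S, T))
  - c * (complex.Re (\tr S) - 1) = c.
Proof.
move=> Zh; rewrite [sdp_lmi P _]/= -{2}(ctr1 d) ipmx_lmiD subrK.
rewrite ipmxDl ipmxNl ipmx_scalarl ipmx1l /=; ring.
Qed.

(** The gap is the pairing of the two constraint matrices. *)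
Lemma weak_duality S T c Z :
  feasible D (S, T) -> feasible P (c, Z) -> sdp_obj D (S, T) <= c.
Proof.
move=> /feasibleD[Sh Wp St] /feasibleP[Zh Np].
have := psd_ipmx Wp Np; have := lagrangianP T c Z Sh St => /= <- ip0.
by rewrite gerBl.
Qed.

(** The Lagrangian at the multiplier with blocks [S], [Y], [U] has slope
   [1 - tr S] in [c] and [Phi S - U] in [Z]. It is bounded below exactly when
   both vanish, and these are the constraints of (D) with [T = - Y]. *)
Lemma probD_dual_of_probP :
  is_dual_of_min P D (fun ST => (sdp_lmi D ST, 0)).
Proof.
have dualE S T : feasible D (S, T) ->
    min_dual_fun P (sdp_lmi D (S, T), 0) = (sdp_obj D (S, T))%:E.
  move=> /feasibleD[Sh _ St]; apply: (@inf_val_cst _ _ _ _ (0, 0)).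
    exact: herm0.
  move=> [c Z] _; rewrite /min_lagrangian big_ord0 addr0.
  exact: lagrangianP.
split=> [|[S T]]; last exact: dualE.
split.
- move=> [S T] /= STf; split; first by case: STf.
  by rewrite dualE.
- move=> [S T] [S' T'] _ _ [/eq_block_mx[-> /oppr_inj -> _ _]] //.
move=> [W mu] [/= Wp fin]; have [Sh Uh WE] := herm_blockP Wp.1.
move: (ulsubmx W) (ursubmx W) (drsubmx W) Sh Uh WE => S Y U Sh Uh WE.
have LE c Z : min_lagrangian P (W, mu) (c, Z) =
    c - (c * complex.Re (\tr S) - ipmx A0 S + ipmx (U - Phi A S) Z
         + 2 * complex.Re (\tr Y)).
  by rewrite /min_lagrangian big_ord0 addr0 WE ipmx_lmiP.
have tr1 : \tr S = 1.
  have : 1 - complex.Re (\tr S) = 0.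
    apply: (inf_val_slope (g := fun t => (t, 0))
      (b := ipmx A0 S - 2 * complex.Re (\tr Y)) _ _ fin) => [t|t].
      exact: herm0.
    by rewrite LE ipmx0r; ring.
  move=> /eqP; rewrite subr_eq0 => /eqP St.
  by rewrite -(herm_trace_real Sh) -St.
have Hh : U - Phi A S \is hermsymmx by rewrite hermB ?Phi_herm.
have U0 : U - Phi A S = 0.
  apply/ipmx_eq0/oppr_inj; rewrite oppr0.
  apply: (inf_val_slope (g := fun t => (0, t%:C *: (U - Phi A S)))
    (b := ipmx A0 S - 2 * complex.Re (\tr Y)) _ _ fin) => [t|t].
    exact: hermZ.
  by rewrite LE ipmxZr; ring.
have UE : U = Phi A S by apply/eqP; rewrite -subr_eq0 U0.
have lmiE : sdp_lmi D (S, - Y) = W by rewrite WE UE /= ctrN !opprK.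
exists (S, - Y).
  by apply/feasibleD; split; [exact: Sh | move: Wp; rewrite -lmiE | exact: tr1].
by apply: (congr2 pair lmiE); apply/rowP => -[].
Qed.

(** At the multipliers [X], [Y], [Z] and [mu], the Lagrangian has slope
   [2 (1 - Y)] in [T] and [A0 + X + Phi Z - mu] in [S]; where both vanish, the
   multiplier is the constraint matrix of (P) at [(mu, Z)]. *)
Lemma probP_dual_of_probD :
  is_dual_of_max D P (fun cZ => (sdp_lmi P cZ, const_mx cZ.1)).
Proof.
have LagE W mu S T : max_lagrangian D (W, mu) (S, T) =
    sdp_obj D (S, T) + ipmx W (sdp_lmi D (S, T))
    - mu 0 0 * (complex.Re (\tr S) - 1).
  by rewrite /max_lagrangian big_ord1 mxE.
have dualE c Z : feasible P (c, Z) ->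
    max_dual_fun D (sdp_lmi P (c, Z), const_mx c) = c%:E.
  move=> /feasibleP[Zh _]; apply: (@sup_val_cst _ _ _ _ (0, 0)).
    exact: herm0.
  by move=> [S T] _; rewrite LagE mxE lagrangianD.
split=> [|[c Z]]; last exact: dualE.
split.
- move=> [c Z] /= cZf; split; first by case: cZf.
  by rewrite dualE.
- move=> [c Z] [c' Z'] _ _ [/eq_block_mx[_ _ _ ->]] /rowP/(_ 0).
  by rewrite !mxE => ->.
move=> [W mu] [/= Wp fin]; have [Xh Zh WE] := herm_blockP Wp.1.
move: (ulsubmx W) (ursubmx W) (drsubmx W) Xh Zh WE => X Y Z Xh Zh WE.
have {}LagE S T : max_lagrangian D (W, mu) (S, T) =
    mu 0 0 + ipmx (A0 + X + Phi A Z - (mu 0 0)%:C%:M) S + 2 * ipmx (1%:M - Y) T.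
  rewrite LagE WE ipmx_lmiD !(ipmxDl, ipmxNl) ipmx_scalarl ipmx1l /=; ring.
have Y1 : 1%:M - Y = 0.
  have : 2 * ipmx (1%:M - Y) (1%:M - Y) = 0.
    apply: (sup_val_slope (g := fun t => (0, t%:C *: (1%:M - Y)))
      (b := mu 0 0) _ _ fin) => [t|t].
      exact: herm0.
    by rewrite LagE ipmx0r ipmxZr; ring.
  by move=> /eqP; rewrite mulf_eq0 pnatr_eq0 /= => /eqP/ipmx_eq0.
have Hh : A0 + X + Phi A Z - (mu 0 0)%:C%:M \is hermsymmx.
  apply: hermB (herm_scalar _ _); apply: hermD (Phi_herm A_herm Zh).
  exact: hermD.
have X0 : A0 + X + Phi A Z - (mu 0 0)%:C%:M = 0.
  apply: ipmx_eq0; set H := (_ - _) in Hh *.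
  apply: (sup_val_slope (g := fun t => (t%:C *: H, 0))
    (b := mu 0 0) _ _ fin) => [t|t].
    exact: hermZ.
  by rewrite LagE -/H ipmx0r ipmxZr; ring.
have YE : Y = 1%:M by apply/eqP; rewrite eq_sym -subr_eq0 Y1.
have XE : X = (mu 0 0)%:C%:M - A0 - Phi A Z.
  move/eqP: X0; rewrite subr_eq0 => /eqP <-.
  by rewrite addrAC addrK [A0 + X]addrC addrK.
have lmiE : sdp_lmi P (mu 0 0, Z) = W by rewrite WE YE XE /= ctr1.
exists (mu 0 0, Z).
  by apply/feasibleP; split; [exact: Zh | move: Wp; rewrite -lmiE].
by apply: (congr2 pair lmiE); apply/rowP => j; rewrite mxE !ord1.
Qed.

End Lagrangians.

(** * Strong duality *)

Section StrongDuality.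
Context {R : realType} {d n : nat}.
Notation C := R[i].
Variables (A0 : 'M[C]_d) (A : 'I_n -> 'M[C]_d).
Hypotheses (d_gt0 : (0 < d)%N) (A0_herm : A0 \is hermsymmx)
  (A_herm : forall i, A i \is hermsymmx).
Notation P := (probP A0 A).
Notation D := (probD A0 A).

(** The point [W] of the cone with blocks [S], [- T], [U] is dual feasible
   with value [v] iff its image has blocks [0], [1] and [v]: the first block
   measures [U - Phi S], the second is the trace of [S], and the third is the
   objective, written in a complex linear way that agrees with it on Hermitian
   matrices. *)
Definition dual_map (W : 'M[C]_(d + d)) : 'M[C]_(d + (1 + 1)) :=
  block_mx (drsubmx W - Phi A (ulsubmx W)) 0 0
    (block_mx (\tr (ulsubmx W))%:M 0 0
       (\tr (A0 *m ulsubmx W) - \tr (ursubmx W) - \tr (dlsubmx W))%:M).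

Lemma dual_map_linear (a : R) X Y :
  dual_map (a%:C *: X + Y) = a%:C *: dual_map X + dual_map Y.
Proof.
rewrite /dual_map; have [-> -> -> ->] := submx_linear a%:C X Y.
rewrite !scale_block_mx !add_block_mx !scaler0 !addr0.
congr block_mx.
  by rewrite Phi_linear scalerBr opprD addrACA.
congr (block_mx _ 0 0 _); rewrite -scalar_mx1_linear; congr (_%:M).
  by rewrite mxtraceD mxtraceZ.
by rewrite mulmxDr -scalemxAr !mxtraceD !mxtraceZ; ring.
Qed.

Lemma dual_map_ker W : psd W -> dual_map W = 0 -> W = 0.
Proof.
move=> Wp; have [_ _ WE] := herm_blockP Wp.1.
rewrite /dual_map -(block_mx0 _ d (1 + 1) d (1 + 1)) => /eq_block_mx[U0 _ _].
rewrite -(block_mx0 _ 1 1 1 1) => /eq_block_mx[tr0 _ _ _].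
have ul0 : ulsubmx W = 0.
  apply: psd_trace_eq0; first by have := Wp; rewrite {1}WE => /psd_block_ul.
  by have /matrixP/(_ 0 0) := tr0; rewrite !mxE /= mulr1n => ->.
by apply: psd_diag_blocks_eq0 => //; move: U0; rewrite ul0 Phi0 subr0.
Qed.

Lemma ipmx_dual_map Z a b S Y U :
  ipmx (block_mx Z 0 0 (block_mx (a%:C%:M : 'M_1) 0 0 (b%:C%:M : 'M_1)))
    (dual_map (block_mx S Y (Y^t*) U)) =
  ipmx Z (U - Phi A S) + a * complex.Re (\tr S)
  + b * (ipmx A0 S - 2 * complex.Re (\tr Y)).
Proof.
rewrite /dual_map block_mxKul block_mxKur block_mxKdl block_mxKdr.
rewrite !ipmx_blockD !ipmx_scalarl !mxtrace_scalar !mulr1n addrA.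
congr (_ + _ * _).
by rewrite !ReD !ReN mxtrace_ctr ReJ /ipmx (hermP _).1 //; ring.
Qed.

Lemma psd_trace_one : exists2 S : 'M[C]_d, psd S & \tr S = 1.
Proof.
exists ((d%:R^-1)%:C%:M).
  by rewrite -scalemx1; apply: psdZ (psd1 _); rewrite invr_ge0 ler0n.
rewrite mxtrace_scalar -[LHS]mulr_natr -natC -rmorphM.
by rewrite mulVf // pnatr_eq0 -lt0n.
Qed.

Lemma feasibleD0 S : psd S -> \tr S = 1 -> feasible D (S, 0).
Proof.
move=> Sp St; apply/feasibleD; split; [exact: Sp.1 | | exact: St].
by rewrite ctr0 !oppr0; exact: psd_blockD Sp (Phi_psd A_herm Sp).
Qed.

(** The constraint matrix of (P) with a homogenizing coefficient: [y = -1]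
   gives back (P), see [pencil_lmi]. Pairing the separating residual with
   [dual_map] is pairing [pencil] with the cone, see [ipmx_pencil]. *)
Definition pencil (x y : R) (Z : 'M[C]_d) : 'M[C]_(d + d) :=
  block_mx (x%:C%:M - Phi A Z + y%:C *: A0) (- y%:C%:M) (- y%:C%:M) Z.

Lemma pencil_herm x y Z : Z \is hermsymmx -> pencil x y Z \is hermsymmx.
Proof.
move=> Zh; have Bh : x%:C%:M - Phi A Z + y%:C *: A0 \is hermsymmx.
  exact: hermD (hermB (herm_scalar d x) (Phi_herm A_herm Zh)) (hermZ y A0_herm).
by have := herm_block (- y%:C%:M) Bh Zh; rewrite ctrN ctr_scalar.
Qed.

Lemma pencil_scale t x y Z :
  t%:C *: pencil x y Z = pencil (t * x) (t * y) (t%:C *: Z).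
Proof.
rewrite /pencil scale_block_mx scalerDr scalerBr scalerN !scale_scalar_mx.
by rewrite PhiZ scalerA !rmorphM.
Qed.

Lemma pencil_lmi c Z : pencil c (-1) Z = sdp_lmi P (c, Z).
Proof.
rewrite /pencil /= rmorphN1 scaleN1r addrAC.
by rewrite (_ : - (-1)%:M = 1%:M) // raddfN opprK.
Qed.

Lemma ipmx_pencil x y Z S Y U :
  ipmx (pencil x y Z) (block_mx S Y (Y^t*) U) =
  ipmx Z (U - Phi A S) + x * complex.Re (\tr S)
  + y * (ipmx A0 S - 2 * complex.Re (\tr Y)).
Proof.
have -> : pencil x y Z = block_mx (x%:C%:M - Phi A Z + y%:C *: A0)
    (- y%:C%:M) ((- y%:C%:M)^t*) Z by rewrite ctrN ctr_scalar.
rewrite ipmx_block ctrN ctr_scalar mulNmx mul_scalar_mx linearN linearZ ReN ReZ.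
rewrite ipmxDl ipmxDl ipmxNl ipmxZl ipmx_scalarl (ipmx_Phi A_herm).
by rewrite ipmxDr ipmxNr; ring.
Qed.

(** If no dual feasible point had value [v], the residual of the separation
   theorem would give [a], [b], [Z] with [pencil a b Z] positive semidefinite
   and [a + b * v < 0]. For [b < 0], rescaling produces a primal feasible
   point below [v]; for [b > 0], some dual feasible point has a value above
   [v]; for [b = 0], the block [a - Phi Z] has a negative trace. *)
Lemma dual_attained v :
  (forall c Z, feasible P (c, Z) -> v <= c) ->
  (forall S T, feasible D (S, T) -> sdp_obj D (S, T) <= v) ->
  exists S T, feasible D (S, T) /\ sdp_obj D (S, T) = v.
Proof.
move=> vP vD.
pose p : 'M[C]_(d + (1 + 1)) := block_mx 0 0 0 (block_mx 1%:M 0 0 v%:C%:M).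
have [W0 [W0p W00 Wpos]] :=
  closed_image_separation dual_map_linear dual_map_ker p.
have [Sh Uh WE] := herm_blockP W0p.1.
move: (ulsubmx W0) (ursubmx W0) (drsubmx W0) Sh Uh WE => S Y U Sh Uh WE.
pose Z := U - Phi A S; pose a := complex.Re (\tr S) - 1.
pose b := ipmx A0 S - 2 * complex.Re (\tr Y) - v.
have Zh : Z \is hermsymmx by apply: hermB (Phi_herm A_herm Sh).
have rE : dual_map W0 - p =
    block_mx Z 0 0 (block_mx (a%:C%:M : 'M_1) 0 0 (b%:C%:M : 'M_1)).
  rewrite /dual_map /p WE block_mxKul block_mxKur block_mxKdl block_mxKdr.
  rewrite !opp_block_mx !add_block_mx !oppr0 !addr0.
  congr (block_mx _ 0 0 _); rewrite -!scalar_mx1B.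
  congr (block_mx _%:M 0 0 _%:M).
    by rewrite -(herm_trace_real Sh) -(rmorph1 (real_complex R)) -rmorphB.
  have AS : \tr (A0 *m S) = (ipmx A0 S)%:C.
    rewrite /ipmx (hermP _).1 // RRe_real //; apply/CrealP.
    rewrite -mxtrace_ctr ctrM (hermP _).1 // [in LHS](hermP _).1 //.
    by rewrite mxtrace_mulC.
  by rewrite AS mxtrace_ctr -(addrA (ipmx A0 S)%:C) -opprD addJ -!rmorphB.
rewrite {}rE in W00 Wpos.
have {}Wpos S' Y' U' : psd (block_mx S' Y' (Y'^t*) U') ->
    0 <= ipmx Z (U' - Phi A S') + a * complex.Re (\tr S')
         + b * (ipmx A0 S' - 2 * complex.Re (\tr Y')).
  by move=> /Wpos; rewrite ipmx_dual_map.
move: W00; rewrite WE ipmx_dual_map -/Z => W00.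
(* The residual is orthogonal to the nearest point. *)
have E : ipmx Z Z + a ^+ 2 + b ^+ 2 = - (a + b * v).
  by apply/eqP; rewrite -subr_eq0 -[X in _ == X]W00 /a /b; apply/eqP; ring.
have Z0 := ipmx_ge0 Z; have a2 := sqr_ge0 a; have b2 := sqr_ge0 b.
have [F Fp Ftr] := psd_trace_one.
have [ab0|abn0] := eqVneq (a + b * v) 0.
  have [Z00 a0 b0] : [/\ ipmx Z Z = 0, a = 0 & b = 0].
    rewrite ab0 oppr0 in E.
    have Zz : ipmx Z Z = 0 by lra.
    have a20 : a ^+ 2 = 0 by lra.
    have b20 : b ^+ 2 = 0 by lra.
    by split=> //; apply/eqP; rewrite -sqrf_eq0 ?a20 ?b20.
  have UE : U = Phi A S.
    by apply/eqP; rewrite -subr_eq0; apply/eqP/ipmx_eq0.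
  have Str : complex.Re (\tr S) = 1 by rewrite /a in a0; lra.
  exists S, (- Y); split.
    apply/feasibleD; split; first exact: Sh.
      by rewrite ctrN !opprK -UE -WE.
    by rewrite -(herm_trace_real Sh) Str.
  by rewrite /= linearN ReN; rewrite /b in b0; lra.
have ab_lt0 : a + b * v < 0.
  rewrite lt_neqAle abn0 /=.
  by rewrite -oppr_ge0 -E !addr_ge0.
have Mp : psd (pencil a b Z).
  apply: psd_dual => [|W Wp]; first exact: pencil_herm.
  have [_ _ W'E] := herm_blockP Wp.1; have := Wp; rewrite W'E => /Wpos.
  by rewrite ipmx_pencil.
have [b_lt0|b_gt0|b0] := ltgtP b 0.
- have nb : 0 < - b by rewrite oppr_gt0.
  have nbV : 0 <= (- b)^-1 by rewrite invr_ge0 ltW.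
  have : feasible P ((- b)^-1 * a, (- b)^-1%:C *: Z).
    apply/feasibleP; split; first exact: hermZ.
    have bb : (- b)^-1 * b = -1 by rewrite invrN mulNr mulVf // lt_eqF.
    by have := psdZ nbV Mp; rewrite pencil_scale bb pencil_lmi.
  by move=> /vP; rewrite mulrC ler_pdivlMr //; lra.
- have F0 : psd (block_mx F 0 (0^t*) (Phi A F)).
    by rewrite ctr0; exact: psd_blockD Fp (Phi_psd A_herm Fp).
  have := vD _ _ (feasibleD0 Fp Ftr); have := Wpos _ _ _ F0.
  rewrite subrr ipmx0r Ftr /= mxtrace0 !mulr0 subr0 addr0 add0r mulr1.
  move=> Wge leF.
  by have := ler_wpM2l (ltW b_gt0) leF; lra.
- rewrite b0 mul0r addr0 in ab_lt0.
  have Zp := psd_block_dr Mp; have := psd_trace_ge0 (psd_block_ul Mp).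
  rewrite b0 scale0r addr0 mxtraceD ReD linearN ReN mxtrace_scalar.
  have := psd_trace_ge0 (Phi_psd A_herm Zp).
  have -> : complex.Re (a%:C *+ d) = a * d%:R.
    by rewrite -[in LHS]mulr_natr -natC -rmorphM.
  have : a * d%:R < 0 by rewrite nmulr_rlt0 // ltr0n.
  lra.
Qed.

(** A matrix of the cone is the constraint matrix of (P) at [(v, Z)] iff its
   image has blocks [v - A0], [1] and [1]: adding [Phi Z] to the upper left
   block eliminates [Z]. *)
Definition primal_map (N : 'M[C]_(d + d)) : 'M[C]_(d + d) :=
  block_mx (ulsubmx N + Phi A (drsubmx N)) (ursubmx N) (dlsubmx N) 0.

Lemma primal_map_linear (a : R) X Y :
  primal_map (a%:C *: X + Y) = a%:C *: primal_map X + primal_map Y.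
Proof.
rewrite /primal_map; have [-> -> -> ->] := submx_linear a%:C X Y.
rewrite scale_block_mx add_block_mx scaler0 addr0; congr block_mx.
by rewrite Phi_linear scalerDr addrACA.
Qed.

Hypothesis A_ker : forall x : 'cV[C]_d, (forall i, A i *m x = 0) -> x = 0.

(** Every [A i *m Z *m A i] is positive semidefinite and their sum vanishes,
   so each does; hence [Z *m A i = 0], and the columns of [Z] lie in the
   common kernel. *)
Lemma Phi_faithful Z : psd Z -> Phi A Z = 0 -> Z = 0.
Proof.
move=> Zp PZ0.
have AZAp i : psd (A i *m Z *m A i).
  by rewrite -{1}((hermP _).1 (A_herm i)); exact: psd_congr.
have trP : \sum_i complex.Re (\tr (A i *m Z *m A i)) = 0.
  have <- : complex.Re (\tr (Phi A Z)) =
      \sum_i complex.Re (\tr (A i *m Z *m A i)).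
    by rewrite /Phi (big_morph mxtrace (@mxtraceD _ d) (@mxtrace0 _ d)) Re_sum.
  by rewrite PZ0 mxtrace0.
have AZA i : A i *m Z *m A i = 0.
  apply: (psd_trace_eq0 (AZAp i)); apply/eqP; move/eqP: trP.
  rewrite psumr_eq0 => [/allP/(_ i (mem_index_enum _)) //|j _].
  exact: psd_trace_ge0 (AZAp j).
have ZA i : Z *m A i = 0.
  apply/matrixP => j k; rewrite [RHS]mxE.
  pose e := delta_mx k (0 : 'I_1) : 'cV[C]_d.
  have : Z *m (A i *m e) = 0.
    apply: (psd_form_eq0 Zp).
    have -> : (A i *m e)^t* *m Z *m (A i *m e) = e^t* *m (A i *m Z *m A i) *m e.
      by have /hermP Ah := A_herm i; rewrite ctrM Ah !mulmxA.
    by rewrite AZA mulmx0 mul0mx mxE.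
  by rewrite mulmxA -colE => /colP/(_ j); rewrite !mxE.
apply/matrixP => j k; rewrite [RHS]mxE.
have : Z *m delta_mx k (0 : 'I_1) = 0.
  apply: A_ker => i; rewrite mulmxA.
  have -> : A i *m Z = 0.
    have /hermP Zh := Zp.1; have /hermP Ah := A_herm i.
    by rewrite -(trmxCK (A i *m Z)) ctrM Zh Ah ZA ctr0.
  by rewrite mul0mx.
by rewrite -colE => /colP/(_ j); rewrite !mxE.
Qed.

Lemma primal_map_ker N : psd N -> primal_map N = 0 -> N = 0.
Proof.
move=> Np; have [_ _ NE] := herm_blockP Np.1.
have ulp : psd (ulsubmx N) by have := Np; rewrite {1}NE => /psd_block_ul.
have drp : psd (drsubmx N).
  by have := Np; rewrite {1}NE => /psd_block_dr.
move=> pN; have /eq_block_mx[e _ _ _] := etrans pN (esym (block_mx0 _ d d d d)).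
have Pp := Phi_psd A_herm drp.
have tr0 : complex.Re (\tr (ulsubmx N)) +
    complex.Re (\tr (Phi A (drsubmx N))) = 0.
  by rewrite -ReD -mxtraceD e mxtrace0.
have t1 := psd_trace_ge0 ulp; have t2 := psd_trace_ge0 Pp.
apply: psd_diag_blocks_eq0 => //; first by apply: psd_trace_eq0 => //; lra.
by apply: Phi_faithful => //; apply: psd_trace_eq0 => //; lra.
Qed.

(** The images of feasible points [(c, Z)] tend to the target as [c] tends to
   [v]. A separating residual [r] would be nonnegative on them and negative on
   the target, so the target is attained. *)
Lemma primal_attained v : (forall c Z, feasible P (c, Z) -> v <= c) ->
  (forall e, 0 < e -> exists c Z, feasible P (c, Z) /\ c < v + e) ->
  exists Z, feasible P (v, Z).
Proof.
move=> vlb vP; pose p : 'M[C]_(d + d) := block_mx (v%:C%:M - A0) 1%:M 1%:M 0.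
have [N0 [N0p N00 Npos]] :=
  closed_image_separation primal_map_linear primal_map_ker p.
have [r rE] : exists r, r = primal_map N0 - p by eexists.
rewrite -rE in N00 Npos.
have rp : ipmx r p = - ipmx r r.
  by rewrite {3}rE ipmxDr N00 ipmxNr; ring.
pose t := ipmx r (block_mx 1%:M 0 0 0).
have rr_le e : 0 < e -> ipmx r r <= e * `|t|.
  move=> e0; have [c [Z [/feasibleP[Zh Np] cv]]] := vP e e0.
  have cv0 : v <= c.
    by apply: vlb; apply/feasibleP; split; [exact: Zh | exact: Np].
  have := Npos _ Np.
  have -> : primal_map (block_mx (c%:C%:M - A0 - Phi A Z) 1%:M 1%:M Z) =
      p + (c - v)%:C *: block_mx 1%:M 0 0 0.
    rewrite /primal_map block_mxKul block_mxKur block_mxKdl block_mxKdr subrK.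
    rewrite scale_block_mx add_block_mx !scaler0 !addr0 scalemx1 rmorphB raddfB.
    by congr block_mx; rewrite [RHS]addrC addrA subrK.
  rewrite ipmxDr ipmxZr rp -/t => rt.
  apply: (@le_trans _ _ ((c - v) * `|t|)).
    apply: (@le_trans _ _ ((c - v) * t)); first by lra.
    by rewrite ler_wpM2l ?subr_ge0 // ler_norm.
  by rewrite ler_wpM2r //; lra.
have r0 : r = 0.
  apply: ipmx_eq0; apply/eqP; rewrite eq_le ipmx_ge0 andbT leNgt.
  apply/negP => r0.
  have t1 : 0 < `|t| + 1 by rewrite ltr_wpDl.
  have := rr_le (ipmx r r / (`|t| + 1)) (divr_gt0 r0 t1).
  by rewrite mulrAC ler_pdivlMr // mulrDr; lra.
have [Bh Zh NE] := herm_blockP N0p.1.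
exists (drsubmx N0); apply/feasibleP; split; first exact: Zh.
move/esym/eqP: rE; rewrite r0 subr_eq0 => /eqP/eq_block_mx[e1 e2 e3 _].
rewrite -e1 addrK.
suff -> : block_mx (ulsubmx N0) 1%:M 1%:M (drsubmx N0) = N0 by [].
by rewrite -[RHS]submxK e2 e3.
Qed.

End StrongDuality.

Theorem theorem1p9 (R : realType) (d n : nat)
    (A0 : 'M[R[i]]_d) (A : 'I_n -> 'M[R[i]]_d)
    (d_gt0 : (0 < d)%N) (n_gt0 : (0 < n)%N)
    (A0_herm : A0 \is hermsymmx) (A_herm : forall i, A i \is hermsymmx) :
  let P := probP A0 A in
  let D := probD A0 A in
  let Lambda := Lambda_sc A0 A in
  [/\ (* the values of (P), (D) and (D') *)
      [/\ inf_val (feasible P) (sdp_obj P) = Lambda,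
          sup_val (feasible D) (sdp_obj D) = Lambda
        & sup_val (feasibleD' (R := R) (d := d)) (objD' A0 A) = Lambda],
      (* (P) and (D) are Lagrangian duals of one another *)
      is_dual_of_min P D (fun ST => (sdp_lmi D ST, 0)) /\
      is_dual_of_max D P (fun cZ => (sdp_lmi P cZ, const_mx cZ.1)),
      (* the suprema are attained *)
      attained (feasible D) (sdp_obj D)
        (sup_val (feasible D) (sdp_obj D)) /\
      attained (feasibleD' (R := R) (d := d)) (objD' A0 A)
        (sup_val (feasibleD' (R := R) (d := d)) (objD' A0 A))
    & (* the infima are attained when the A_i have no common kernel *)
      (forall x : 'cV[R[i]]_d, (forall i, A i *m x = 0) -> x = 0) ->
      attained (feasible P) (sdp_obj P)
        (inf_val (feasible P) (sdp_obj P)) /\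
      attained [set Z | posdef Z] (lehner A0 A)
        (inf_val [set Z | posdef Z] (lehner A0 A))].
Proof.
move=> P D Lambda; have infP := inf_probP d_gt0 A0_herm A_herm.
have [F Fp Ftr] := psd_trace_one (R := R) d_gt0.
have D0 := feasibleD0 A0 A_herm Fp Ftr.
have [Z0 P0] : exists Z, feasible P Z.
  exists (lehner A0 A 1%:M, invmx 1%:M); apply: lehner_feasible => //.
  by apply: psd_posdef (psd1 _) _ => x; rewrite mul1mx.
have weak ST cZ : feasible D ST -> feasible P cZ -> sdp_obj D ST <= cZ.1.
  by case: ST cZ => [S T] [c Z] /(weak_duality A_herm); apply.
have [v vE] : exists v, Lambda = v%:E.
  have lb : ((sdp_obj D (F, 0%R))%:E <= Lambda)%E.
    rewrite -[Lambda]infP; apply: le_ereal_inf_tmp => _ [cZ cZf <-].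
    by rewrite lee_fin; exact: weak D0 cZf.
  have ub : (Lambda <= (sdp_obj P Z0)%:E)%E.
    by rewrite -[Lambda]infP; apply: ereal_inf_lbound; exists Z0.
  by case: Lambda lb ub => [v| |] // _ _; exists v.
have vP c Z : feasible P (c, Z) -> v <= c.
  move=> cZf; rewrite -lee_fin -vE -[Lambda]infP.
  by apply: ereal_inf_lbound; exists (c, Z).
have vD S T : feasible D (S, T) -> sdp_obj D (S, T) <= v.
  move=> STf; rewrite -lee_fin -vE -[Lambda]infP.
  apply: le_ereal_inf_tmp => _ [cZ cZf <-].
  by rewrite lee_fin; exact: weak STf cZf.
have [S [T [STf STv]]] := dual_attained d_gt0 A0_herm A_herm vP vD.
(* At a fixed [S], maximizing over [T] turns (D) into (D'). *)
have objD'_le X : feasibleD' X -> objD' A0 A X <= v.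
  move=> [Xp Xt].
  have [T' Bp TE] := block_trace_attained Xp (Phi_psd A_herm Xp).
  have /vD : feasible D (X, T') by apply/feasibleD; split; [exact: Xp.1| |].
  by rewrite /= TE.
have /feasibleD[Sh Bp St] := STf.
have Sf : feasibleD' S := conj (psd_block_ul Bp) St.
have objD'_S : objD' A0 A S = v.
  apply/eqP; rewrite eq_le objD'_le //= -STv /objD' /= lerD2l ler_pM2l //.
  exact: block_trace_le.
have supD : sup_val (feasible D) (sdp_obj D) = v%:E.
  apply/eqP; rewrite eq_le; apply/andP; split.
    by apply: ge_ereal_sup => _ [[S' T'] /vD le_v <-]; rewrite lee_fin.
  by apply: ereal_sup_ubound; exists (S, T) => //; rewrite STv.
have supD' : sup_val (@feasibleD' R d) (objD' A0 A) = v%:E.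
  apply/eqP; rewrite eq_le; apply/andP; split.
    by apply: ge_ereal_sup => _ [X /objD'_le le_v <-]; rewrite lee_fin.
  by apply: ereal_sup_ubound; exists S => //; rewrite objD'_S.
split.
- by rewrite supD supD' vE -vE.
- split; first exact: probD_dual_of_probP.
  exact: probP_dual_of_probD.
- split; first by exists (S, T); rewrite // supD STv.
  by exists S; rewrite // supD' objD'_S.
move=> A_ker.
have near e : 0 < e -> exists c Z, feasible P (c, Z) /\ c < v + e.
  move=> e0; have : (inf_val (feasible P) (sdp_obj P) < (v + e)%:E)%E.
    by rewrite infP -[Lambda_sc _ _]/Lambda vE lte_fin ltrDl.
  by move=> /ereal_inf_lt[_ [[c Z] cZf <-]]; rewrite lte_fin; exists c, Z.
have [Z Zf] := primal_attained A_herm A_ker vP near.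
split; first by exists (v, Z) => //; rewrite infP -[Lambda_sc _ _]/Lambda vE.
have [Zp leZ] := feasible_lehner d_gt0 A0_herm A_herm Zf.
exists (invmx Z) => //; rewrite -[inf_val _ _]/Lambda vE; congr (_%:E).
apply/eqP; rewrite eq_le leZ -lee_fin -vE.
by apply: ereal_inf_lbound; exists (invmx Z).
Qed.
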